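(* Assume that conditions (A-i) and (A-ii) of the context hold, that $\bar\Sigma_m\in\mathcal U(r,s_0,M,\varepsilon_0)$, that $d=o(m^{q/8})$, and that the threshold is $t_m=C_{th}\,d^{4/q}/\sqrt m$ for some large enough constant $C_{th}$. Let $\bar\Phi_m=\bar\Sigma_m^{-1}$ and $\hat\Phi_m=(\mathcal S_{t_m}\hat\Sigma_m)^{-1}$. Then $$\|\hat\Phi_m-\bar\Phi_m\|_{op}=O_{\mathbb P}\Big(\Big(\frac{d^{4/q}}{\sqrt m}\Big)^{1-r}\Big),\qquad m\to\infty .$$ Moreover, a projection vector given by $v=v_m=f(\bar\Sigma_m^{-1},\bar\mu_m)$, for some Lipschitz continuous function $f$, can be estimated by $$\hat v_m=f\big((\mathcal S_{t_m}\hat\Sigma_m)^{-1},\hat\mu_m\big)$$ at the same convergence rate, i.e. $\|\hat v_m-v\|_2=O_{\mathbb P}\big((d^{4/q}/\sqrt m)^{1-r}\big)$, provided the estimator $\hat\mu_m$ attains the same convergence rate, i.e. $\|\hat\mu_m-\bar\mu_m\|_2=O_{\mathbb P}\big((d^{4/q}/\sqrt m)^{1-r}\big)$.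
   Context: Model. $m\in\mathbb N$ is the sample size, $d=d_m$ the dimension. Let $(\epsilon_t)_{t\in\mathbb Z}$ be i.i.d. uniform on $(0,1)$ and $(\epsilon_t')$ an independent copy. Put $\boldsymbol\epsilon_t=(\epsilon_t,\epsilon_{t-1},\dots)$ and, for $j\le t$, $\boldsymbol\epsilon_{t,j}=(\epsilon_t,\dots,\epsilon_{j+1},\epsilon_j',\epsilon_{j-1},\dots)$. The observations are $Y_t=(Y_{t1},\dots,Y_{td})^\top=G_t(\boldsymbol\epsilon_t)$, $t\ge1$, with measurable maps $G_t=(G_{tj})_{j=1}^d:\mathbb R^\infty\to\mathbb R^d$; everything may depend on $m$. $\mu_t=(\mu_{tj})_j=\mathbb EY_t$. Constants in the conditions are independent of $d$ and $m$. (A-i) For some $\beta>2$, $q>4$ and constants $K,C_1$: $\|\mu_t\|_\infty\le K$, $(\mathbb E|G_{tj}(\boldsymbol\epsilon_0)-\mu_{tj}|^q)^{1/q}\le K$ and $(\mathbb E|G_{tj}(\boldsymbol\epsilon_t)-G_{tj}(\boldsymbol\epsilon_{t,t-\ell})|^q)^{1/q}\le C_1\ell^{-\beta}$ for all $1\le j\le d$, $\ell\ge1$, $t\ge1$. (A-ii) There is $L>0$ such that $\max_{1\le j\le d}\sum_{t=2}^n(\mathbb E|G_{tj}(\boldsymbol\epsilon_0)-G_{t-1,j}(\boldsymbol\epsilon_0)|^4)^{1/4}\le KL$ for all $n\ge1$. Estimators. $\hat\mu_m=\frac1m\sum_{t=1}^mY_t$, $\hat\Sigma_m=\frac1m\sum_{t=1}^m(Y_t-\hat\mu_m)(Y_t-\hat\mu_m)^\top$,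 $\hat M_m=\frac1m\sum_{t=1}^mY_tY_t^\top$, $\bar\mu_m=\mathbb E\hat\mu_m$, $\bar M_m=\mathbb E\hat M_m$, $\bar\Sigma_m=\bar M_m-\bar\mu_m\bar\mu_m^\top$. Class. For $0\le r<1$ and constants $M$, $\varepsilon_0$, $s_0=s_0(d)$, $$\mathcal U(r,s_0,M,\varepsilon_0)=\Big\{\Sigma:\ \Sigma_{ii}\le M,\ \sum_{j=1}^d|\Sigma_{ij}|^r\le s_0,\ 1\le i\le d,\ \lambda_{\min}(\Sigma)\ge\varepsilon_0>0\Big\}.$$ Thresholding. $\mathcal S_t$ is a soft-thresholding operator with threshold $t$: a map on $\mathbb R^{d\times d}$ acting entrywise with, for all $x\in\mathbb R$: $|\mathcal S_t(x)|\le|x|$; $\mathcal S_t(x)=0$ for $|x|\le t$; $|\mathcal S_t(x)-x|\le t$. $\|\cdot\|_{op}$ is the spectral norm. Lipschitz continuity of $f$ is with respect to the spectral norm in the matrix argument and the Euclidean norm for vectors, with Lipschitz constant independent of $d$ and $m$.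
   Formalization: The sparsity bound s_0(d) is additionally assumed to be bounded by a constant independent of d and m; with s_0(d) unbounded the stated rate, which carries no factor s_0, fails. *)

(* Defs.v *)
From HB Require Import structures.
From mathcomp Require Import all_boot all_order all_algebra.
From mathcomp Require Import all_classical all_reals all_analysis.

Set Implicit Arguments.
Unset Strict Implicit.
Unset Printing Implicit Defensive.

Import Order.TTheory GRing.Theory Num.Theory.
Import numFieldNormedType.Exports.

Local Open Scope classical_set_scope.
Local Open Scope ring_scope.

Definition norm2 (R : realType) (n : nat) (x : 'cV[R]_n) : R :=
  Num.sqrt (\sum_(i < n) x i 0 ^+ 2).

Definition opnorm (R : realType) (n : nat) (A : 'M[R]_n) : R :=
  sup [set norm2 (A *m x) | x in [set x : 'cV[R]_n | norm2 x <= 1]].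

(* For symmetric A and 0 < n, the set of eigenvalues is finite and nonempty,
   so the infimum is a minimum. *)
Definition lambda_min (R : realType) (n : nat) (A : 'M[R]_n) : R :=
  inf [set a : R | eigenvalue A a].

(* |x|^r with 0^r = 0 also for r = 0: a sum of such terms then counts the
   nonzero entries when r = 0, whereas powR has 0 `^ 0 = 1. *)
Definition abspow (R : realType) (r x : R) : R :=
  if x == 0 then 0 else `|x| `^ r.

Definition sparse_class (R : realType) (n : nat) (r s0 M eps0 : R) :
    set 'M[R]_n :=
  [set S : 'M[R]_n | [/\ forall i, S i i <= M,
               forall i, \sum_(j < n) abspow r (S i j) <= s0,
               0 < eps0 & eps0 <= lambda_min S]].

(* S t is the scalar operator with threshold t; it is applied to matrices
   entrywise, through map_mx. *)
Definition soft_thresholding (R : realType) (S : R -> R -> R) : Prop :=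
  forall t : R, 0 <= t -> forall x : R,
    [/\ `|S t x| <= `|x|, `|x| <= t -> S t x = 0 & `|S t x - x| <= t].

(* A family f_m of Lipschitz maps with a common constant, which therefore
   depends neither on m nor on the dimension. *)
Definition lipschitz_family (R : realType) (dim : nat -> nat)
    (f : forall m : nat, 'M[R]_(dim m) -> 'cV[R]_(dim m) -> 'cV[R]_(dim m)) :
    Prop :=
  exists Lf : R, forall (m : nat) (A B : 'M[R]_(dim m)) (a b : 'cV[R]_(dim m)),
    norm2 (f m A a - f m B b) <= Lf * (opnorm (A - B) + norm2 (a - b)).

(* X_m = O_P(a_m). No measurability of X_m is required: the probability is the
   outer one, mu_ext P, which agrees with P on measurable events. *)
Definition bigO_prob (R : realType) (disp : measure_display)
    (T : measurableType disp) (P : probability T R)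
    (X : nat -> T -> R) (a : nat -> R) : Prop :=
  forall delta : R, 0 < delta -> exists B : R, 0 < B /\
    \forall m \near \oo,
      (mu_ext P [set w | (B * a m < `|X m w|)%R] <= delta%:E)%E.

Definition mutually_independent (R : realType) (disp : measure_display)
    (T : measurableType disp) (P : probability T R) (I : eqType)
    (X : I -> {RV P >-> R}) : Prop :=
  forall (s : seq I) (A : I -> set R), uniq s -> (forall i, measurable (A i)) ->
    P (\big[setI/setT]_(i <- s) (X i @^-1` A i)) =
    (\prod_(i <- s) P (X i @^-1` A i))%E.

(* e is i.i.d. uniform on (0,1) and e' is an independent copy of e: the two
   sequences together form a single i.i.d. family indexed by int + int. *)
Definition iid_uniform_copies (R : realType) (disp : measure_display)
    (T : measurableType disp) (P : probability T R)
    (e e' : int -> {RV P >-> R}) : Prop :=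
  let X := fun i : int + int => match i with inl t => e t | inr t => e' t end in
  mutually_independent X /\
  forall (i : int + int) (A : set R), measurable A ->
    distribution P (X i) A = uniform_prob (@ltr01 R) A.

Definition past (R : realType) (T : Type) (e : int -> T -> R) (t : int) (w : T) :
    nat -> R :=
  fun k => e (t - k%:Z) w.

Definition coupled_past (R : realType) (T : Type) (e e' : int -> T -> R)
    (t j : int) (w : T) : nat -> R :=
  fun k => if t - k%:Z == j then e' j w else e (t - k%:Z) w.

Definition cylinders (R : realType) : set (set (nat -> R)) :=
  [set A | exists (k : nat) (B : set R),
     measurable B /\ A = (fun x : nat -> R => x k) @^-1` B].

(* R^oo carries the sigma-algebra generated by the cylinders, i.e. the product
   Borel sigma-algebra. *)
Definition measurable_seq_map (R : realType) (n : nat)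
    (g : (nat -> R) -> 'cV[R]_n) : Prop :=
  forall j : 'I_n, measurable_fun setT
    ((fun x => g x j 0) : g_sigma_algebraType (@cylinders R) -> R).

(* Entrywise expectation; fine sends a non-finite expectation to 0, but the
   moment bounds below make all the expectations used here finite. *)
Definition expect_mx (R : realType) (disp : measure_display)
    (T : measurableType disp) (P : probability T R) (p q : nat)
    (X : T -> 'M[R]_(p, q)) : 'M[R]_(p, q) :=
  \matrix_(i, j) fine ('E_P[fun w => X w i j])%E.

Definition observation (R : realType) (T : Type) (n : nat) (e : int -> T -> R)
    (G : nat -> (nat -> R) -> 'cV[R]_n) (t : nat) (w : T) : 'cV[R]_n :=
  G t (past e t%:Z w).

Definition norm_Lp (R : realType) (disp : measure_display)
    (T : measurableType disp) (P : probability T R) (p : R) (X : T -> R) :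
    \bar R :=
  Lnorm P p%:E (EFin \o X).

Definition dependence_condition (R : realType) (disp : measure_display)
    (T : measurableType disp) (P : probability T R)
    (e e' : int -> {RV P >-> R}) (n : nat)
    (G : nat -> (nat -> R) -> 'cV[R]_n) (beta q K C1 : R) : Prop :=
  let mu := fun t => expect_mx P (observation e G t) in
  forall (t : nat) (j : 'I_n), (1 <= t)%N ->
    [/\ `|mu t j 0| <= K,
        (norm_Lp P q (fun w => G t (past e 0 w) j 0 - mu t j 0)%R
           <= K%:E)%E &
        forall l : nat, (1 <= l)%N ->
          (norm_Lp P q (fun w =>
             G t (past e t%:Z w) j 0
             - G t (coupled_past e e' t%:Z (t%:Z - l%:Z) w) j 0)%R
           <= (C1 * l%:R `^ (- beta))%R%:E)%E].

Definition bounded_variation_condition (R : realType) (disp : measure_display)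
    (T : measurableType disp) (P : probability T R)
    (e : int -> {RV P >-> R}) (n : nat)
    (G : nat -> (nat -> R) -> 'cV[R]_n) (K L : R) : Prop :=
  forall (N : nat) (j : 'I_n), (1 <= N)%N ->
    (\sum_(2 <= t < N.+1)
       norm_Lp P 4 (fun w =>
         G t (past e 0 w) j 0 - G t.-1 (past e 0 w) j 0)%R
     <= (K * L)%R%:E)%E.

Definition sample_mean (R : realType) (T : Type) (n : nat)
    (Y : nat -> T -> 'cV[R]_n) (m : nat) (w : T) : 'cV[R]_n :=
  m%:R^-1 *: \sum_(1 <= t < m.+1) Y t w.

Definition sample_cov (R : realType) (T : Type) (n : nat)
    (Y : nat -> T -> 'cV[R]_n) (m : nat) (w : T) : 'M[R]_n :=
  m%:R^-1 *: \sum_(1 <= t < m.+1)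
    ((Y t w - sample_mean Y m w) *m (Y t w - sample_mean Y m w)^T).

Definition sample_moment (R : realType) (T : Type) (n : nat)
    (Y : nat -> T -> 'cV[R]_n) (m : nat) (w : T) : 'M[R]_n :=
  m%:R^-1 *: \sum_(1 <= t < m.+1) (Y t w *m (Y t w)^T).

Definition mean_bar (R : realType) (disp : measure_display)
    (T : measurableType disp) (P : probability T R) (n : nat)
    (Y : nat -> T -> 'cV[R]_n) (m : nat) : 'cV[R]_n :=
  expect_mx P (sample_mean Y m).

Definition cov_bar (R : realType) (disp : measure_display)
    (T : measurableType disp) (P : probability T R) (n : nat)
    (Y : nat -> T -> 'cV[R]_n) (m : nat) : 'M[R]_n :=
  expect_mx P (sample_moment Y m) - mean_bar P Y m *m (mean_bar P Y m)^T.

Definition dim_rate (R : realType) (dim : nat -> nat) (q : R) (m : nat) : R :=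
  (dim m)%:R `^ (4 / q) / Num.sqrt m%:R.

(* invmx A = A when A is singular; this only fixes the value of the estimator
   on the event where its inverse does not exist. *)
Definition precision_hat (R : realType) (T : Type) (n : nat)
    (S : R -> R -> R) (thr : R) (Y : nat -> T -> 'cV[R]_n) (m : nat) (w : T) :
    'M[R]_n :=
  invmx (map_mx (S thr) (sample_cov Y m w)).

(* Main.v *)
Require Import Defs.
From HB Require Import structures.
From mathcomp Require Import all_boot all_order all_algebra.
From mathcomp Require Import all_classical all_reals all_analysis.
From mathcomp Require Import measurable_realfun zify ring lra.

Set Implicit Arguments.
Unset Strict Implicit.
Unset Printing Implicit Defensive.

Import Order.TTheory GRing.Theory Num.Theory.
Import numFieldNormedType.Exports.

Local Open Scope classical_set_scope.
Local Open Scope ring_scope.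

(** Write Sigma for the target covariance, E for the entrywise error of the
    sample covariance, rho = d^(4/q) / sqrt m and t = Cth * rho for the
    threshold.  The proof combines a moment bound for each entry of E with a
    deterministic analysis of thresholding.

    Moments.  Every entry of E has an L^(q/2) norm of order m^(-1/2)
    ([norm_Lp_cov_error]).  This reduces to centred averages of functions
    X_t = h_t(past) ([norm_Lp_mean_deviation]), used for single coordinates
    with exponent q and for products of two coordinates with exponent q/2.
    Martingale differences are replaced by a symmetry argument, so that no
    conditional expectation appears.  Let X_t^l be X_t with its l most recent
    innovations replaced by fresh ones that only time t uses, and let
    D_t^l = X_t^l - X_t^(l+1).  Exchanging the innovation at lag l with its
    fresh copy preserves the joint law of all innovations, changes the sign of
    D_t^l and fixes D_s^l for s < t.  Hence E|S + D_t^l|^p = E|S - D_t^l|^p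
    for S the sum of the D_s^l with s < t, and a two-point inequality bounds
    the L^p norm of the sum over t by a multiple of sqrt m times the bound for
    one term ([norm_Lp_increment_sum]).  The norm of D_t^l is summable in l,
    which bounds the sum over t of X_t - X_t^l in L^p uniformly in l.  As l
    grows, X_t^l tends in probability to a function of fresh innovations only
    ([reindexed_cvg_probability]); its sum over t is independent of the
    observations and has the same mean, and Jensen's inequality turns the
    bound on the difference into one on the deviation from the mean
    ([norm_Lp_centered_sum]).

    Thresholding.  Markov's inequality gives, with probability close to one,
    that the sum over i, j of |E_ij|^(q/2) is at most B * rho^(q/2) with B
    large.  This does not put max |E_ij| below the threshold, whose constant
    is fixed before B.  The entries with |E_ij| > t/2 are therefore separated:
    since q/2 > 2, the squared Frobenius norm of that part is at most a
    constant times t^(2 - q/2) times the sum of the |E_ij|^(q/2), hence of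
    order rho^2.  At all other entries the error of the thresholded estimator
    is at most 3 |Sigma_ij|^r t^(1-r), and the row sums of this symmetric
    majorant bound the spectral norm ([threshold_opbound]).  Finally
    |Sigma x| >= eps0 |x| makes inversion Lipschitz near Sigma
    ([invmx_perturbation]). *)

(** * Euclidean norm, operator bounds and the smallest eigenvalue *)

Lemma cauchy_schwarz_sum (R : realFieldType) (n : nat) (u v : 'I_n -> R) :
  (\sum_i u i * v i) ^+ 2 <= (\sum_i u i ^+ 2) * (\sum_i v i ^+ 2).
Proof.
set U := \sum_i u i ^+ 2; set V := \sum_i v i ^+ 2; set W := \sum_i u i * v i.
have V0 : 0 <= V by apply: sumr_ge0 => i _; exact: sqr_ge0.
have [V1|V1] := eqVneq V 0.
  have v0 i : v i = 0.
    apply/eqP; rewrite -sqrf_eq0; apply/eqP.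
    by apply: (psumr_eq0P _ V1) => // j _; exact: sqr_ge0.
  by rewrite /W big1 ?expr0n/= ?V1 ?mulr0// => i _; rewrite v0 mulr0.
have : 0 <= \sum_i (V * u i - W * v i) ^+ 2.
  by apply: sumr_ge0 => i _; exact: sqr_ge0.
have -> : \sum_i (V * u i - W * v i) ^+ 2 = V * (U * V - W ^+ 2).
  have -> : \sum_i (V * u i - W * v i) ^+ 2 =
     \sum_i (V ^+ 2 * u i ^+ 2 + (- (2 * V * W)) * (u i * v i) + W ^+ 2 * v i ^+ 2).
    by apply: eq_bigr => i _; ring.
  by rewrite !big_split/= -!mulr_sumr -/U -/V -/W; ring.
by rewrite pmulr_rge0 ?subr_ge0 // lt0r V1.
Qed.

Section Euclidean.
Variable R : realType.

Definition dot n (x y : 'cV[R]_n) : R := \sum_i x i 0 * y i 0.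

Lemma norm2_ge0 n (x : 'cV[R]_n) : 0 <= norm2 x.
Proof. exact: sqrtr_ge0. Qed.

Lemma norm2_sqr n (x : 'cV[R]_n) : norm2 x ^+ 2 = \sum_i x i 0 ^+ 2.
Proof. by rewrite sqr_sqrtr// sumr_ge0// => i _; exact: sqr_ge0. Qed.

Lemma dotxx n (x : 'cV[R]_n) : dot x x = norm2 x ^+ 2.
Proof. by rewrite norm2_sqr; apply: eq_bigr => i _; rewrite expr2. Qed.

Lemma dotC n (x y : 'cV[R]_n) : dot x y = dot y x.
Proof. by apply: eq_bigr => i _; rewrite mulrC. Qed.

Lemma dotDl n (x y z : 'cV[R]_n) : dot (x + y) z = dot x z + dot y z.
Proof. by rewrite -big_split/=; apply: eq_bigr => i _; rewrite mxE mulrDl. Qed.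

Lemma dotZl n a (x y : 'cV[R]_n) : dot (a *: x) y = a * dot x y.
Proof. by rewrite mulr_sumr; apply: eq_bigr => i _; rewrite mxE mulrA. Qed.

Lemma dot0l n (y : 'cV[R]_n) : dot 0 y = 0.
Proof. by rewrite /dot big1// => i _; rewrite mxE mul0r. Qed.

Lemma dotDr n (x y z : 'cV[R]_n) : dot z (x + y) = dot z x + dot z y.
Proof. by rewrite !(dotC z) dotDl. Qed.

Lemma dotZr n a (x y : 'cV[R]_n) : dot x (a *: y) = a * dot x y.
Proof. by rewrite !(dotC x) dotZl. Qed.

Lemma dot_mulmx n (A : 'M[R]_n) (x y : 'cV[R]_n) :
  dot (A *m x) y = dot x (A^T *m y).
Proof.
rewrite /dot; under eq_bigr do rewrite mxE mulr_suml.
rewrite exchange_big/=; apply: eq_bigr => i _.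
by rewrite mxE mulr_sumr; apply: eq_bigr => j _; rewrite mxE; ring.
Qed.

Lemma dot_le n (x y : 'cV[R]_n) : dot x y <= norm2 x * norm2 y.
Proof.
apply: (le_trans (ler_norm _)); rewrite -(@ler_pXn2r _ 2)// ?nnegrE//.
  by rewrite real_normK ?num_real// exprMn !norm2_sqr; exact: cauchy_schwarz_sum.
by rewrite mulr_ge0 ?norm2_ge0.
Qed.

Lemma norm2_eq0 n (x : 'cV[R]_n) : norm2 x = 0 -> x = 0.
Proof.
move=> /(congr1 (fun z => z ^+ 2)); rewrite norm2_sqr expr0n/= => h.
apply/matrixP => i j; rewrite ord1 mxE; apply/eqP; rewrite -sqrf_eq0; apply/eqP.
by apply: (psumr_eq0P _ h) => // k _; exact: sqr_ge0.
Qed.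

Lemma norm20 n : norm2 (0 : 'cV[R]_n) = 0.
Proof. by rewrite /norm2 big1 ?sqrtr0// => i _; rewrite mxE expr0n. Qed.

Lemma norm2Z n a (x : 'cV[R]_n) : norm2 (a *: x) = `|a| * norm2 x.
Proof.
apply/eqP; rewrite -(@eqrXn2 _ 2)// ?norm2_ge0 ?mulr_ge0 ?norm2_ge0//.
rewrite exprMn !norm2_sqr real_normK ?num_real// mulr_sumr.
by apply/eqP; apply: eq_bigr => i _; rewrite mxE exprMn.
Qed.

Lemma norm2D n (x y : 'cV[R]_n) : norm2 (x + y) <= norm2 x + norm2 y.
Proof.
rewrite -(@ler_pXn2r _ 2)// ?nnegrE ?addr_ge0 ?norm2_ge0//.
rewrite -dotxx dotDl !dotDr !dotxx (dotC y x).
by have := dot_le x y; nra.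
Qed.

Lemma norm2N n (x : 'cV[R]_n) : norm2 (- x) = norm2 x.
Proof. by rewrite -scaleN1r norm2Z normrN1 mul1r. Qed.

(** Bounds on the spectral norm are handled pointwise; this avoids the
    existence of the supremum in [opnorm]. *)
Definition opbound n (A : 'M[R]_n) (c : R) : Prop :=
  forall x : 'cV[R]_n, norm2 (A *m x) <= c * norm2 x.

Lemma opbound_sqr n (A : 'M[R]_n) (c : R) : 0 <= c ->
  (forall x : 'cV[R]_n, \sum_i (A *m x) i 0 ^+ 2 <= c ^+ 2 * \sum_i x i 0 ^+ 2) ->
  opbound A c.
Proof.
move=> c0 h x; rewrite -(@ler_pXn2r _ 2)// ?nnegrE ?mulr_ge0 ?norm2_ge0//.
by rewrite exprMn !norm2_sqr.
Qed.

Lemma opboundD n (A B : 'M[R]_n) a b : opbound A a -> opbound B b ->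
  opbound (A + B) (a + b).
Proof.
move=> hA hB x; rewrite mulmxDl mulrDl.
by apply: (le_trans (norm2D _ _)); apply: lerD.
Qed.

Lemma opbound_frobenius n (A : 'M[R]_n) (c : R) : 0 <= c ->
  \sum_i \sum_j A i j ^+ 2 <= c ^+ 2 -> opbound A c.
Proof.
move=> c0 h; apply: opbound_sqr => // x.
apply: (@le_trans _ _ (\sum_i (\sum_j A i j ^+ 2) * (\sum_j x j 0 ^+ 2))).
  by apply: ler_sum => i _; rewrite mxE; exact: cauchy_schwarz_sum.
by rewrite -mulr_suml ler_wpM2r// sumr_ge0// => i _; exact: sqr_ge0.
Qed.

Lemma opbound_exists n (A : 'M[R]_n) : exists2 c, 0 < c & opbound A c.
Proof.
set s := \sum_i \sum_j A i j ^+ 2.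
have s0 : 0 <= s by do 2 (apply: sumr_ge0 => ? _); exact: sqr_ge0.
exists (s + 1); first by lra.
by apply: opbound_frobenius; [lra|rewrite -/s; nra].
Qed.

(** Schur test: the weighted Cauchy-Schwarz inequality with weights [b i j],
    then exchange of the two sums, where symmetry identifies the column sums
    of [b] with its row sums. *)
Lemma opbound_schur n (A b : 'M[R]_n) (s : R) :
  (forall i j, `|A i j| <= b i j) -> (forall i j, b i j = b j i) ->
  0 <= s -> (forall i, \sum_j b i j <= s) -> opbound A s.
Proof.
move=> Ab bC s0 bs; apply: opbound_sqr => // x.
have b0 i j : 0 <= b i j by exact: le_trans (Ab i j).
apply: (@le_trans _ _ (\sum_i s * \sum_j b i j * x j 0 ^+ 2)).
  apply: ler_sum => i _.
  apply: (@le_trans _ _ ((\sum_j b i j) * \sum_j b i j * x j 0 ^+ 2)); last first.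
    apply: ler_wpM2r => //; apply: sumr_ge0 => j _.
    by rewrite mulr_ge0// sqr_ge0.
  have h1 : `|(A *m x) i 0| <= \sum_j Num.sqrt (b i j) * (Num.sqrt (b i j) * `|x j 0|).
    rewrite mxE; apply: (le_trans (ler_norm_sum _ _ _)).
    apply: ler_sum => j _; rewrite mulrA -expr2 sqr_sqrtr// normrM.
    by rewrite ler_wpM2r.
  apply: (@le_trans _ _ (`|(A *m x) i 0| ^+ 2)); first by rewrite real_normK ?num_real.
  apply: (@le_trans _ _ ((\sum_j Num.sqrt (b i j) * (Num.sqrt (b i j) * `|x j 0|)) ^+ 2)).
    by rewrite ler_pXn2r// nnegrE// (le_trans _ h1).
  apply: (le_trans (cauchy_schwarz_sum _ _)).
  rewrite le_eqVlt; apply/orP; left; apply/eqP; congr (_ * _).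
    by apply: eq_bigr => j _; rewrite sqr_sqrtr.
  by apply: eq_bigr => j _; rewrite exprMn sqr_sqrtr// real_normK ?num_real.
rewrite -mulr_sumr expr2 -mulrA ler_wpM2l// exchange_big/= mulr_sumr.
apply: ler_sum => j _; rewrite -mulr_suml ler_wpM2r ?sqr_ge0//.
by rewrite (eq_bigr (fun i => b j i))// => i _; rewrite bC.
Qed.

Lemma opnorm_le n (A : 'M[R]_n) (c : R) : 0 <= c -> opbound A c ->
  `|opnorm A| <= c.
Proof.
move=> c0 h.
have ub : ubound [set norm2 (A *m x) | x in [set x : 'cV[R]_n | norm2 x <= 1]] c.
  move=> _ [x /= x1 <-]; apply: (le_trans (h x)).
  by rewrite ler_piMr.
have m0 : [set norm2 (A *m x) | x in [set x : 'cV[R]_n | norm2 x <= 1]] 0.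
  by exists 0; rewrite /= ?norm20// mulmx0 norm20.
rewrite ger0_norm; first by apply: ge_sup => //; exists 0.
by apply: ub_le_sup => //; exists c.
Qed.

(** Both sides are homogeneous of degree two. *)
Lemma rayleigh_quotient n (A : 'M[R]_n) (a : R) :
  (forall u : 'cV[R]_n, norm2 u = 1 -> a <= dot u (A *m u)) ->
  forall x : 'cV[R]_n, a * norm2 x ^+ 2 <= dot x (A *m x).
Proof.
move=> h x; have [x0|x0] := eqVneq (norm2 x) 0.
  by rewrite (norm2_eq0 x0) mulmx0 norm20 expr0n/= mulr0 dot0l.
have := h ((norm2 x)^-1 *: x).
rewrite norm2Z ger0_norm ?invr_ge0 ?norm2_ge0// mulVf// => /(_ erefl).
rewrite -scalemxAr dotZl dotZr mulrA -expr2 exprVn mulrC ler_pdivlMr//.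
by rewrite exprn_gt0// lt0r x0 norm2_ge0.
Qed.

(** The infimum l of the Rayleigh quotient is itself an eigenvalue, which
    gives the claim.  Otherwise B = A - l is invertible and nonnegative, so
    |Bx|^2 <= b <x, Bx> together with |x| <= c' |Bx| makes the quotient of B
    bounded away from 0, against the choice of l. *)
Lemma lambda_min_dot n (A : 'M[R]_n) (e : R) : A^T = A -> 0 < e ->
  e <= lambda_min A -> forall x : 'cV[R]_n, e * norm2 x ^+ 2 <= dot x (A *m x).
Proof.
move=> As e0 eA.
have eig a : eigenvalue A a -> e <= a.
  move=> Aa; apply: (le_trans eA); rewrite /lambda_min.
  (* the infimum of a set without one is 0, which is smaller than e *)
  have hi : has_inf [set a : R | eigenvalue A a].
    apply: contrapT => /inf_out h; move: eA; rewrite /lambda_min h.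
    by rewrite leNgt e0.
  by apply: ge_inf => //; exact: hi.2.
have [c c0 Ac] := opbound_exists A.
pose E := [set dot x (A *m x) | x in [set x : 'cV[R]_n | norm2 x = 1]].
have Elb : lbound E (- c).
  move=> _ [x /= x1 <-].
  have := dot_le (- x) (A *m x); rewrite norm2N x1 mul1r -scaleN1r dotZl mulN1r.
  by have := Ac x; rewrite x1; lra.
have [E0|/set0P En] := eqVneq E set0.
  apply: rayleigh_quotient => x x1.
  by have : E (dot x (A *m x)) by [exists x]; rewrite E0.
suff infE : e <= inf E.
  apply: rayleigh_quotient => x x1; apply: (le_trans infE).
  by apply: ge_inf; [exists (- c)|exists x].
set l := inf E in eig *.
pose B := A - l%:M.
have Bs : B^T = B by rewrite /B linearB/= As tr_scalar_mx.
have dotB x : dot x (B *m x) = dot x (A *m x) - l * norm2 x ^+ 2.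
  by rewrite mulmxBl -mulNmx -scaleN1r scale_scalar_mx mul_scalar_mx dotDr dotZr dotxx; ring.
have El : forall x, l * norm2 x ^+ 2 <= dot x (A *m x).
  apply: rayleigh_quotient => x x1.
  by apply: ge_inf; [exists (- c)|exists x].
have Bpos x : 0 <= dot x (B *m x) by rewrite dotB subr_ge0.
have [b b0 Bb] := opbound_exists B.
(* expand the nonnegative form of B at x - b^-1 B x *)
have Bsq x : norm2 (B *m x) ^+ 2 <= b * dot x (B *m x).
  have := Bpos (x - b^-1 *: (B *m x)).
  rewrite mulmxBr -scalemxAr -!scaleNr !(dotDl, dotDr, dotZl, dotZr).
  rewrite dotxx.
  have -> : dot x (B *m (B *m x)) = norm2 (B *m x) ^+ 2.
    by rewrite -dotxx dot_mulmx Bs.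
  have : dot (B *m x) (B *m (B *m x)) <= b * norm2 (B *m x) ^+ 2.
    apply: (le_trans (dot_le _ _)); rewrite expr2 mulrCA.
    by rewrite ler_wpM2l ?norm2_ge0.
  set N := norm2 _ ^+ 2; set D := dot _ (B *m (B *m x)) => hD.
  set Q := dot x _ => h.
  have bb : b^-1 * D <= N by rewrite mulrC ler_pdivrMr// mulrC.
  have : 0 <= b * (Q + - b^-1 * N + (- b^-1 * N - b^-1 * (- b^-1 * D))).
    by rewrite mulr_ge0 ?(ltW b0)//; move: h; rewrite mulNr; lra.
  have -> : b * (Q + - b^-1 * N + (- b^-1 * N - b^-1 * (- b^-1 * D))) =
     b * Q - 2 * N + b^-1 * D by field; rewrite gt_eqF.
  by lra.
have [Bu|Bn] := boolP (B \in unitmx).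
  exfalso.
  have [c' c'0 hc'] := opbound_exists (invmx B).
  have lowB x : norm2 x ^+ 2 <= c' ^+ 2 * b * dot x (B *m x).
    have := hc' (B *m x); rewrite mulKmx// => h.
    apply: (@le_trans _ _ (c' ^+ 2 * norm2 (B *m x) ^+ 2)).
      rewrite -exprMn ler_pXn2r// ?nnegrE ?mulr_ge0 ?norm2_ge0//; lra.
    by rewrite -mulrA ler_wpM2l ?sqr_ge0.
  have k0 : 0 < (c' ^+ 2 * b)^-1 by rewrite invr_gt0 mulr_gt0 ?exprn_gt0.
  have hE : has_inf E by split => //; exists (- c).
  have [_ [x /= x1 <-]] := inf_adherent k0 hE.
  apply/negP; rewrite -leNgt -/l.
  have := lowB x; rewrite x1 expr1n dotB x1 expr1n mulr1 => h.
  rewrite -lerBrDl -[leLHS]mul1r ler_pdivrMr 1?mulrC//.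
  by rewrite mulr_gt0 ?exprn_gt0.
apply: eig; rewrite /eigenvalue /eigenspace -/B.
rewrite kermx_eq0 row_free_unit.
exact: Bn.
Qed.

End Euclidean.

(** * Perturbation of the inverse and thresholding *)

Section Thresholding.
Variable R : realType.

(** The lower bound on [S] survives, halved, for [A]; both matrices are
    then invertible and the difference of the inverses factors as
    - A^-1 (A - S) S^-1. *)
Lemma invmx_perturbation n (S A : 'M[R]_n) (e c : R) : 0 < e -> 0 <= c ->
  c <= e / 2 -> (forall x : 'cV[R]_n, e * norm2 x <= norm2 (S *m x)) ->
  opbound (A - S) c -> opbound (invmx A - invmx S) (2 / e ^+ 2 * c).
Proof.
move=> e0 c0 ce Slow AS.
have unit_low (B : 'M[R]_n) a : 0 < a ->
    (forall x, a * norm2 x <= norm2 (B *m x)) -> B \in unitmx.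
  move=> a0 Bl; rewrite -unitmx_tr -row_free_unit -kermx_eq0; apply/eqP.
  apply/row_matrixP => i; rewrite row0.
  have h : B *m (row i (kermx B^T))^T = 0.
    apply: trmx_inj; rewrite trmx_mul trmxK -row_mul mulmx_ker row0 trmx0.
    by [].
  apply: trmx_inj; rewrite trmx0; apply: norm2_eq0.
  have := Bl (row i (kermx B^T))^T; rewrite h norm20 pmulr_rle0// => h'.
  by apply/eqP; rewrite eq_le h' norm2_ge0.
have Alow x : e / 2 * norm2 x <= norm2 (A *m x).
  have -> : A *m x = S *m x - (- ((A - S) *m x)).
    by rewrite opprK mulmxBl addrC subrK.
  have h1 := Slow x; have h2 := AS x.
  have h3 : norm2 (S *m x) <= norm2 (S *m x - - ((A - S) *m x)) + norm2 ((A - S) *m x).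
    have := norm2D (S *m x - - ((A - S) *m x)) (- ((A - S) *m x)).
    by rewrite addrNK norm2N.
  have h4 : c * norm2 x <= e / 2 * norm2 x by rewrite ler_wpM2r ?norm2_ge0.
  by move: h1 h2 h3 h4; set N := norm2 x; lra.
have uS := unit_low _ _ e0 Slow.
have e20 : 0 < e / 2 by rewrite divr_gt0.
have uA := unit_low _ _ e20 Alow.
have E : invmx A - invmx S = - (invmx A *m (A - S) *m invmx S).
  by rewrite mulmxBr mulmxBl mulVmx// mul1mx -mulmxA mulmxV// mulmx1 opprB.
move=> x; rewrite E mulNmx norm2N -!mulmxA.
have h1 : norm2 (invmx S *m x) <= e^-1 * norm2 x.
  have := Slow (invmx S *m x); rewrite mulKVmx// => h.
  by rewrite mulrC ler_pdivlMr// mulrC.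
set y := invmx S *m x in h1 *.
have h2 := AS y; set z := (A - S) *m y in h2 *.
have h3 : norm2 (invmx A *m z) <= (e / 2)^-1 * norm2 z.
  have := Alow (invmx A *m z); rewrite mulKVmx// => h.
  by rewrite mulrC ler_pdivlMr// mulrC.
apply: (le_trans h3).
apply: (@le_trans _ _ ((e / 2)^-1 * (c * (e^-1 * norm2 x)))).
  rewrite ler_wpM2l ?invr_ge0 ?(ltW e20)//.
  by apply: (le_trans h2); rewrite ler_wpM2l.
by rewrite le_eqVlt; apply/orP; left; apply/eqP; field; rewrite gt_eqF.
Qed.

Lemma lambda_min_norm2 n (A : 'M[R]_n) (e : R) : A^T = A -> 0 < e ->
  e <= lambda_min A -> forall x : 'cV[R]_n, e * norm2 x <= norm2 (A *m x).
Proof.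
move=> As e0 eA x; have h := lambda_min_dot As e0 eA x.
have [->|x0] := eqVneq (norm2 x) 0; first by rewrite mulr0 norm2_ge0.
have n0 : 0 < norm2 x by rewrite lt0r x0 norm2_ge0.
rewrite -(ler_pM2l n0); apply: le_trans (dot_le _ _).
by apply: le_trans h; rewrite expr2; lra.
Qed.

Lemma abspow_ge0 (r x : R) : 0 <= abspow r x.
Proof. by rewrite /abspow; case: ifP => // _; exact: powR_ge0. Qed.

(** Split y = y^r y^(1-r).  The convention 0^0 = 0 in [abspow] is
    consistent: x = 0 forces y = 0. *)
Lemma le_abspow_powR (r t x y : R) : 0 <= r -> r < 1 -> 0 < t ->
  0 <= y -> y <= `|x| -> y <= t -> y <= abspow r x * t `^ (1 - r).
Proof.
move=> r0 r1 t0 y0 yx yt; rewrite /abspow; case: eqVneq => [x0|x0].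
  by move: yx; rewrite x0 normr0 mul0r.
have [->|yn] := eqVneq y 0; first by rewrite mulr_ge0 ?powR_ge0.
have yp : 0 < y by rewrite lt0r yn.
rewrite -{1}(powRr1 y0) -{1}(subrK r 1) addrC powRD; last by rewrite yn implybT.
have r1' : 0 <= 1 - r by lra.
apply: ler_pM; rewrite ?powR_ge0//.
  by apply: ge0_ler_powR => //; rewrite nnegrE.
by apply: ge0_ler_powR => //; rewrite nnegrE ltW.
Qed.

(** The error is at most 3 min(|x|, t): a small [x] is set to 0, and at a
    large one both the noise and the shrinkage are at most [t]. *)
Lemma soft_threshold_entry (S : R -> R -> R) (r t x s : R) :
  soft_thresholding S -> 0 <= r -> r < 1 -> 0 < t ->
  `|s - x| <= t / 2 -> `|S t s - x| <= 3 * (abspow r x * t `^ (1 - r)).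
Proof.
move=> hS r0 r1 t0 e; have [_ S0 S1] := hS t (ltW t0) s.
have m : Num.min `|x| t <= abspow r x * t `^ (1 - r).
  apply: le_abspow_powR => //; last 2 first.
  - by rewrite ge_min lexx.
  - by rewrite ge_min lexx orbT.
  - by rewrite le_min normr_ge0 ltW.
apply: (@le_trans _ _ (3 * Num.min `|x| t)); last by rewrite ler_wpM2l.
have [xt|xt] := leP `|x| (t / 2).
  have st : `|s| <= t.
    by have := ler_normD (s - x) x; rewrite subrK; lra.
  rewrite S0// sub0r normrN /Num.min; case: ifP => _; last lra.
  by have := normr_ge0 x; lra.
have h : `|S t s - x| <= `|S t s - s| + `|s - x|.
  by have := ler_normD (S t s - s) (s - x); rewrite addrA subrK.
by rewrite /Num.min; case: ifP => _; lra.
Qed.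

Lemma soft_threshold_entry_large (S : R -> R -> R) (t x s : R) :
  soft_thresholding S -> 0 < t -> t / 2 < `|s - x| ->
  `|S t s - x| <= 3 * `|s - x|.
Proof.
move=> hS t0 e; have [_ _ S1] := hS t (ltW t0) s.
have h : `|S t s - x| <= `|S t s - s| + `|s - x|.
  by have := ler_normD (S t s - s) (s - x); rewrite addrA subrK.
lra.
Qed.

(** The entries with error at most t/2 obey the symmetric bound of
    [soft_threshold_entry] and are summed by the Schur test.  The others are
    measured in Frobenius norm: where |y| > t/2, y^2 <= |y|^p (t/2)^(2-p). *)
Lemma threshold_opbound n (Sg Sh : 'M[R]_n) (S : R -> R -> R) (r t s0 p D : R) :
  soft_thresholding S -> 0 <= r -> r < 1 -> 0 < t -> 2 <= p -> Sg^T = Sg ->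
  (forall i, \sum_j abspow r (Sg i j) <= s0) -> 0 <= s0 ->
  \sum_i \sum_j `|Sh i j - Sg i j| `^ p <= D ->
  opbound (map_mx (S t) Sh - Sg)
    (3 * s0 * t `^ (1 - r) + 3 * Num.sqrt (D * (t / 2) `^ (2 - p))).
Proof.
move=> hS r0 r1 t0 p2 Ssym row s00 hD.
pose A1 := \matrix_(i, j) (if `|Sh i j - Sg i j| <= t / 2
   then S t (Sh i j) - Sg i j else 0) : 'M[R]_n.
pose A2 := \matrix_(i, j) (if `|Sh i j - Sg i j| <= t / 2
   then 0 else S t (Sh i j) - Sg i j) : 'M[R]_n.
have -> : map_mx (S t) Sh - Sg = A1 + A2.
  by apply/matrixP => i j; rewrite !mxE; case: ifP => _; rewrite ?addr0 ?add0r.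
have t20 : 0 < t / 2 by lra.
apply: opboundD.
  apply: (opbound_schur (b := \matrix_(i, j) (3 * (abspow r (Sg i j) * t `^ (1 - r))))).
  - move=> i j; rewrite !mxE; case: ifP => e; last first.
      by rewrite normr0 !mulr_ge0 ?abspow_ge0 ?powR_ge0.
    exact: soft_threshold_entry.
  - by move=> i j; rewrite !mxE -{1}Ssym mxE.
  - by rewrite !mulr_ge0 ?powR_ge0.
  - move=> i; under eq_bigr do rewrite mxE mulrA.
    by rewrite -mulr_suml ler_wpM2r ?powR_ge0// -mulr_sumr ler_wpM2l.
(* the Frobenius norm of the exceptional entries *)
apply: opbound_frobenius; first by rewrite mulr_ge0 ?sqrtr_ge0.
have sum0 : 0 <= \sum_i \sum_j `|Sh i j - Sg i j| `^ p.
  by do 2 (apply: sumr_ge0 => ? _); exact: powR_ge0.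
rewrite exprMn sqr_sqrtr; last by rewrite mulr_ge0 ?powR_ge0// (le_trans sum0).
apply: (@le_trans _ _ (3 ^+ 2 * ((\sum_i \sum_j `|Sh i j - Sg i j| `^ p) * (t / 2) `^
  (2 - p)))); last first.
  by rewrite ler_wpM2l ?sqr_ge0// ler_wpM2r ?powR_ge0.
rewrite mulr_suml mulr_sumr; apply: ler_sum => i _.
rewrite mulr_suml mulr_sumr; apply: ler_sum => j _.
rewrite mxE; case: ifPn => [_|].
  by rewrite expr0n/= !mulr_ge0 ?powR_ge0// sqr_ge0.
rewrite -ltNge => e; set y := `|Sh i j - Sg i j| in e *.
have y0 : 0 < y by lra.
have h := soft_threshold_entry_large hS t0 e.
apply: (@le_trans _ _ (3 ^+ 2 * y ^+ 2)).
  rewrite -exprMn -(real_normK (num_real (S t _ - _))).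
  by rewrite ler_pXn2r ?nnegrE// mulr_ge0// ltW.
rewrite ler_wpM2l ?sqr_ge0// -powR_mulrn ?(ltW y0)//.
have -> : y `^ 2%:R = y `^ p * y `^ (2 - p).
  by rewrite -powRD ?(gt_eqF y0) ?implybT// addrC subrK.
rewrite ler_wpM2l ?powR_ge0// -(opprB p 2) !powRN lef_pV2 ?posrE ?powR_gt0//.
apply: ge0_ler_powR; rewrite ?nnegrE ?subr_ge0//; exact: ltW.
Qed.

End Thresholding.

(** * Joint laws of the innovations *)

Section ProductSpace.
Variables (R : realType) (J : choiceType).

Definition coord_cylinders : set (set (J -> R)) :=
  [set A | exists (j : J) (B : set R),
     measurable B /\ A = (fun x : J -> R => x j) @^-1` B].

(** The sigma-algebra generated by the coordinates; for [J := nat] it is the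
    one used for measurable maps of sequences. *)
Definition product_space := g_sigma_algebraType coord_cylinders.

Lemma measurable_to_product d (T : measurableType d) (U : T -> J -> R) :
  (forall j, measurable_fun setT (fun w => U w j)) ->
  measurable_fun setT (U : T -> product_space).
Proof.
move=> mU; apply: (@measurability _ _ T product_space setT U coord_cylinders) => //.
move=> _ [_ [j [B [mB ->]]] <-].
rewrite setTI -[X in measurable X]setTI.
exact: mU.
Qed.

Lemma measurable_coord (j : J) :
  measurable_fun setT (fun x : product_space => (x : J -> R) j).
Proof.
move=> _ B mB; rewrite setTI; apply: sub_sigma_algebra.
by exists j, B.
Qed.

Definition same_law d d' (T : measurableType d) (T' : measurableType d')
    (P : probability T R) (P' : probability T' R)
    (U : T -> J -> R) (V : T' -> J -> R) : Prop :=
  forall A : set product_space, measurable A -> P (U @^-1` A) = P' (V @^-1` A).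

Definition rectangle (s : seq J) (A : J -> set R) : set product_space :=
  [set x | forall j, j \in s -> A j (x j)].

Lemma measurable_rectangle (s : seq J) (A : J -> set R) :
  (forall j, measurable (A j)) -> measurable (rectangle s A).
Proof.
move=> mA; elim: s => [|j s IH].
  by rewrite (_ : rectangle _ _ = setT)//; apply/seteqP; split.
have -> : rectangle (j :: s) A =
    (fun x : product_space => (x : J -> R) j) @^-1` A j `&` rectangle s A.
  apply/seteqP; split => x /=.
    move=> h; split; first by apply: h; rewrite inE eqxx.
    by move=> i si; apply: h; rewrite inE si orbT.
  by move=> [h1 h2] i; rewrite inE => /predU1P[->|]//; exact: h2.
apply: measurableI => //.
by rewrite -[X in measurable X]setTI; exact: measurable_coord.
Qed.

(** Rectangles form a pi-system generating the sigma-algebra, so Dynkin's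
    theorem applies. *)
Lemma same_law_rectangles d d' (T : measurableType d) (T' : measurableType d')
    (P : probability T R) (P' : probability T' R)
    (U : T -> J -> R) (V : T' -> J -> R) :
  (forall j, measurable_fun setT (fun w => U w j)) ->
  (forall j, measurable_fun setT (fun w => V w j)) ->
  (forall (s : seq J) (A : J -> set R), uniq s ->
     (forall j, measurable (A j)) ->
     P (U @^-1` rectangle s A) = P' (V @^-1` rectangle s A)) ->
  same_law P P' U V.
Proof.
move=> mU mV h.
pose Uf : {mfun T >-> product_space} :=
  HB.pack (U : T -> product_space) (isMeasurableFun.Build _ _ _ _ _ (measurable_to_product mU)).
pose Vf : {mfun T' >-> product_space} :=
  HB.pack (V : T' -> product_space) (isMeasurableFun.Build _ _ _ _ _
    (measurable_to_product mV)).
pose G : set (set product_space) :=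
  [set B | exists (s : seq J) (A : J -> set R),
     [/\ uniq s, (forall j, measurable (A j)) & B = rectangle s A]].
have GT : G setT.
  by exists [::], (fun=> setT); split => //; apply/seteqP; split.
have mG : <<s coord_cylinders>> = <<s G>>.
  apply/seteqP; split; apply: smallest_sub; try exact: smallest_sigma_algebra.
    move=> _ [j [B [mB ->]]]; apply: sub_sigma_algebra.
    exists [:: j], (fun=> B); split => //.
    apply/seteqP; split => x /=; first by move=> xB i; rewrite inE => /eqP ->.
    by move/(_ j); rewrite inE; exact.
  move=> _ [s [A [us mA ->]]].
  exact: measurable_rectangle.
move=> B mB.
apply: (@measure_unique _ R product_space G (fun=> setT) mG _ _ _
   (pushforward P Uf) (pushforward P' Vf)) => //.
- move=> _ _ [s [A [us mA ->]]] [t [C [ut mC ->]]].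
  exists (undup (s ++ t)),
    (fun j => (if j \in s then A j else setT) `&` (if j \in t then C j else setT)).
  split; [exact: undup_uniq| |].
    by move=> j; apply: measurableI; case: ifP => _ //; exact: measurableT.
  apply/seteqP; split => x /=.
    by move=> [xs xt] j _; split; case: ifP => //; [exact: xs|exact: xt].
  move=> h'; split => j js; have := h' j; rewrite mem_undup mem_cat js ?orbT;
  by move=> /(_ isT) [].
- by rewrite bigcup_const.
- by move=> _ [s [A [us mA ->]]]; exact: h.
- move=> _; change (P (Uf @^-1` setT) < +oo)%E.
  by rewrite preimage_setT probability_setT ltry.
Qed.

Lemma same_law_integral d d' (T : measurableType d) (T' : measurableType d')
    (P : probability T R) (P' : probability T' R)
    (U : T -> J -> R) (V : T' -> J -> R) (F : product_space -> R) :
  (forall j, measurable_fun setT (fun w => U w j)) ->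
  (forall j, measurable_fun setT (fun w => V w j)) ->
  same_law P P' U V -> measurable_fun setT F -> (forall x, 0 <= F x) ->
  (\int[P]_w (F (U w))%:E = \int[P']_w (F (V w))%:E)%E.
Proof.
move=> mU mV UV mF F0.
pose Uf : {mfun T >-> product_space} :=
  HB.pack (U : T -> product_space) (isMeasurableFun.Build _ _ _ _ _ (measurable_to_product mU)).
pose Vf : {mfun T' >-> product_space} :=
  HB.pack (V : T' -> product_space) (isMeasurableFun.Build _ _ _ _ _
    (measurable_to_product mV)).
transitivity (\int[pushforward P Uf]_x (F x)%:E)%E.
  rewrite ge0_integral_pushforward//; first exact/measurable_EFinP.
  by move=> x _; rewrite lee_fin.
transitivity (\int[pushforward P' Vf]_x (F x)%:E)%E; last first.
  rewrite ge0_integral_pushforward//; first exact/measurable_EFinP.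
  by move=> x _; rewrite lee_fin.
by apply: eq_measure_integral => A mA _; exact: UV.
Qed.

End ProductSpace.

Section Independent.
Variables (R : realType) (d : measure_display) (T : measurableType d).
Variable (P : probability T R).

(** Mutual independence is stable under injective reindexing: [A'] carries
    the constraint on coordinate [j] to the index [sg j]. *)
Lemma independent_rectangle (I J : choiceType) (X : I -> {RV P >-> R})
    (sg : J -> I) (s : seq J) (A : J -> set R) :
  mutually_independent X -> injective sg -> uniq s ->
  (forall j, measurable (A j)) ->
  P ((fun w j => X (sg j) w) @^-1` rectangle s A) =
  (\prod_(j <- s) distribution P (X (sg j)) (A j))%E.
Proof.
move=> hX isg us mA.
pose A' i := [set x | forall j, sg j = i -> A j x].
have A'E j : A' (sg j) = A j.
  apply/seteqP; split => x /=; first exact.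
  by move=> Ax k /isg ->.
have mA' i : measurable (A' i).
  have [[j <-]|ni] := pselect (exists j, sg j = i); first by rewrite A'E.
  suff -> : A' i = setT by exact: measurableT.
  by apply/seteqP; split => x //= _ j ji; case: ni; exists j.
have := hX (map sg s) A' _ mA'; rewrite map_inj_uniq// => /(_ us).
rewrite !big_map => h.
transitivity (P (\big[setI/setT]_(j <- s) (X (sg j) @^-1` A' (sg j)))).
  congr (P _); rewrite -bigcap_seq; apply/seteqP; split => w /= hw j js.
    by rewrite A'E; exact: hw.
  by have := hw j js; rewrite A'E.
by rewrite h; apply: eq_bigr => j _; rewrite A'E.
Qed.

Variables (e e' : int -> {RV P >-> R}).
Hypothesis iid : iid_uniform_copies e e'.

Definition innovation (i : int + int) : {RV P >-> R} :=
  match i with inl t => e t | inr t => e' t end.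

Lemma measurable_innovation i : measurable_fun setT (innovation i).
Proof. by case: i => t; exact: measurable_funPT. Qed.

Lemma innovation_rectangle (J : choiceType) (sg : J -> int + int) (s : seq J)
    (A : J -> set R) : injective sg -> uniq s -> (forall j, measurable (A j)) ->
  P ((fun w j => innovation (sg j) w) @^-1` rectangle s A) =
  (\prod_(j <- s) uniform_prob (@ltr01 R) (A j))%E.
Proof.
move=> isg us mA; rewrite independent_rectangle//; last exact: iid.1.
by apply: eq_bigr => j _; exact: iid.2.
Qed.

(** The basic symmetry of the proof: along any injection the innovations
    form the same i.i.d. family. *)
Lemma innovation_reindex (J : choiceType) (sg tau : J -> int + int) :
  injective sg -> injective tau ->
  same_law P P (fun w j => innovation (sg j) w) (fun w j => innovation (tau j) w).
Proof.
move=> isg itau; apply: same_law_rectangles.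
- by move=> j; exact: measurable_innovation.
- by move=> j; exact: measurable_innovation.
- by move=> s A us mA; rewrite !innovation_rectangle.
Qed.

(** Independence of the two sequences, in the form needed for Fubini's
    theorem: they may be read on two independent copies of the probability
    space. *)
Lemma innovation_product :
  same_law P (P \x P)%E (fun w j => innovation j w)
   (fun w j => match j with inl t => e t w.1 | inr t => e' t w.2 end).
Proof.
apply: same_law_rectangles.
- by move=> j; exact: measurable_innovation.
- move=> [t|t].
    by apply: (measurableT_comp (measurable_funPT (e t))).
  by apply: (measurableT_comp (measurable_funPT (e' t))).
move=> s A us mA.
pose l (i : int + int) := if i is inl t then Some t else None.
pose r (i : int + int) := if i is inr t then Some t else None.
have memL t : (t \in pmap l s) = (inl t \in s).
  by elim: (s) => //= -[u|u] s' IH; rewrite !inE ?IH.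
have memR t : (t \in pmap r s) = (inr t \in s).
  by elim: (s) => //= -[u|u] s' IH; rewrite !inE ?IH.
have uL : uniq (pmap l s) by apply: (@pmap_uniq _ _ l inl) => // -[].
have uR : uniq (pmap r s) by apply: (@pmap_uniq _ _ r inr) => // -[].
pose UL w t := innovation (inl t) w; pose UR w t := innovation (inr t) w.
have mUL : measurable_fun setT (UL : T -> product_space R int).
  by apply: measurable_to_product => t; exact: measurable_innovation.
have mUR : measurable_fun setT (UR : T -> product_space R int).
  by apply: measurable_to_product => t; exact: measurable_innovation.
rewrite innovation_rectangle//.
set V := fun w : T * T => _.
have -> : V @^-1` rectangle s A =
   (UL @^-1` rectangle (pmap l s) (A \o inl)) `*`
   (UR @^-1` rectangle (pmap r s) (A \o inr)).
  apply/seteqP; split => -[w1 w2] /=.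
    by move=> h; split => t; rewrite /= ?memL ?memR => ts; exact: (h _ ts).
  by move=> [h1 h2] [t|t] ts; [apply: h1|apply: h2]; rewrite ?memL ?memR.
rewrite [RHS](product_measure1E P P); last 2 first.
- by rewrite -[X in measurable X]setTI; apply: mUL => //;
  apply: measurable_rectangle => j; exact: mA.
- by rewrite -[X in measurable X]setTI; apply: mUR => //;
  apply: measurable_rectangle => j; exact: mA.
transitivity ((\prod_(j <- pmap l s) uniform_prob (@ltr01 R) (A (inl j))) *
   (\prod_(j <- pmap r s) uniform_prob (@ltr01 R) (A (inr j))))%E.
  elim: (s) => [|[t|t] s' IH] /=; rewrite !(big_nil, big_cons) ?mule1//= IH.
    by rewrite muleA.
  by rewrite muleCA.
congr (_ * _)%E; apply/esym.
  by apply: (innovation_rectangle (sg := inl)) => // [? ? []|j] //; exact: mA.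
by apply: (innovation_rectangle (sg := inr)) => // [? ? []|j] //; exact: mA.
Qed.

End Independent.

(** * A two-point inequality and L^p norms *)

Section TwoPoint.
Variable R : realType.

(** With v = u/2 the left side minus 2 is (e^v - e^-v)^2, and
    e^v - e^-v <= 4 v follows from 1 - v <= e^-v. *)
Lemma cosh_le (u : R) : `|u| <= 1 / 2 -> expR u + expR (- u) <= 2 + 4 * u ^+ 2.
Proof.
wlog u0 : u / 0 <= u => [h|].
  have [|un] := leP 0 u; first exact: h.
  by have := h (- u); rewrite normrN opprK sqrrN addrC oppr_ge0 => /(_ (ltW un)).
rewrite ger0_norm// => u1.
set v := u / 2.
have uv : u = v + v by rewrite /v -splitr.
have v0 : 0 <= v by rewrite /v; lra.
have v1 : v <= 1 / 4 by rewrite /v; lra.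
have e1 : 1 - v <= expR (- v) by exact: expR_ge1Dx.
have e0 := expR_gt0 v.
have e2 : expR v * expR (- v) = 1 by rewrite -expRD subrr expR0.
have e3 : expR v * (1 - v) <= 1.
  by rewrite -[leRHS]e2 ler_wpM2l// ltW.
have h : 0 <= expR v - expR (- v) <= 4 * v.
  rewrite subr_ge0 ler_expR; apply/andP; split; first by lra.
  by nra.
rewrite uv opprD !expRD.
by nra.
Qed.

(** Two-uniform smoothness of L^p on the two-point space. *)
Definition smoothness_constant (p C : R) : Prop := 0 < C /\
  forall a b : R, `|a + b| `^ p + `|a - b| `^ p <= 2 * (a ^+ 2 + C * b ^+ 2) `^ (p / 2).

(** If |a| < 4p|b|, the right side dominates through its term in [b].
    Otherwise, with x = b/a, (1+x)^p + (1-x)^p <= e^(px) + e^(-px), which is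
    at most 2 + 4 (px)^2 by [cosh_le], and 1 + 2 (px)^2 is at most its own
    power of exponent p/2. *)
Lemma two_point_inequality (p : R) : 2 <= p -> exists C : R, smoothness_constant p C.
Proof.
move=> p2; exists ((4 * p + 1) ^+ 2); split; first by rewrite exprn_gt0//; lra.
move=> a b; have p0 : 0 <= p by lra.
have p20 : 0 <= p / 2 by lra.
have sq (y : R) : (`|y| ^+ 2) `^ (p / 2) = `|y| `^ p.
  by rewrite -powR_mulrn// -powRrM mulrC divfK.
have [ab|ab] := leP (4 * p * `|b|) `|a|; last first.
  have h (s : R) : `|s| <= (4 * p + 1) * `|b| ->
    `|s| `^ p <= (a ^+ 2 + (4 * p + 1) ^+ 2 * b ^+ 2) `^ (p / 2).
    move=> hs; rewrite -sq; apply: ge0_ler_powR; rewrite ?nnegrE ?sqr_ge0//.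
      by rewrite addr_ge0 ?sqr_ge0// mulr_ge0 ?sqr_ge0.
    apply: (@le_trans _ _ (((4 * p + 1) * `|b|) ^+ 2)).
      by rewrite ler_pXn2r// nnegrE (le_trans _ hs).
    by rewrite exprMn real_normK ?num_real// lerDr sqr_ge0.
  by have := h (a + b); have := h (a - b); have := ler_normD a b; have := ler_normB a b; lra.
have [b0|b0] := eqVneq b 0.
  rewrite b0 addr0 subr0 expr0n/= mulr0 addr0 -(real_normK (num_real a)) sq.
  by rewrite mulr_natl mulr2n.
have a0 : a != 0.
  by apply: contraNneq b0 => a0; move: ab; rewrite a0 normr0 pmulr_rle0 ?normr_le0//; lra.
set x := b / a.
have na : 0 < `|a| by rewrite normr_gt0.
have px : `|p * x| <= 1 / 4.
  rewrite /x !normrM normfV ger0_norm// mulrA ler_pdivrMr//; lra.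
have x1 : `|x| < 1.
  by move: px; rewrite normrM ger0_norm//; have := normr_ge0 x; nra.
have E (s : R) : `|s| < 1 -> `|a + s * a| `^ p <= `|a| `^ p * expR (p * s).
  move=> s1; rewrite -{1}(mul1r a) -mulrDl normrM mulrC powRM// ler_wpM2l ?powR_ge0//.
  have s2 : 0 < 1 + s by move: s1; rewrite ltr_norml; lra.
  rewrite gtr0_norm// mulrC expRM; apply: ge0_ler_powR; rewrite ?nnegrE ?(ltW s2) ?expR_ge0//.
  exact: expR_ge1Dx.
have xb : x * a = b by rewrite /x divfK.
have xb' : a - b = a + (- x) * a by rewrite mulNr xb.
rewrite xb' -{1}xb.
apply: (le_trans (lerD (E _ x1) (E (- x) _))); first by rewrite normrN.
rewrite -mulrDr mulrN.
apply: (@le_trans _ _ (`|a| `^ p * (2 * (1 + 2 * (p * x) ^+ 2)))).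
  rewrite ler_wpM2l ?powR_ge0//; have := @cosh_le (p * x); lra.
rewrite mulrCA ler_wpM2l// -sq real_normK ?num_real//.
have h1 : 1 <= 1 + 2 * (p * x) ^+ 2 by rewrite lerDl mulr_ge0// sqr_ge0.
apply: (@le_trans _ _ ((a ^+ 2) `^ (p / 2) * (1 + 2 * (p * x) ^+ 2) `^ (p / 2))).
  rewrite ler_wpM2l ?powR_ge0// -{1}(powRr1 (le_trans ler01 h1)).
  by apply: ler_powR => //; lra.
rewrite -powRM ?sqr_ge0 ?(le_trans ler01 h1)//.
have -> : a ^+ 2 * (1 + 2 * (p * x) ^+ 2) = a ^+ 2 + 2 * p ^+ 2 * b ^+ 2.
  by rewrite -xb; ring.
have C0 : 0 <= 2 * p ^+ 2 by rewrite mulr_ge0// sqr_ge0.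
have C1 : 2 * p ^+ 2 <= (4 * p + 1) ^+ 2 by nra.
have b2 := sqr_ge0 b; have a2 := sqr_ge0 a.
apply: ge0_ler_powR => //; rewrite ?nnegrE.
- by rewrite addr_ge0// mulr_ge0.
- by rewrite addr_ge0// mulr_ge0// (le_trans C0).
- by rewrite lerD2l ler_wpM2r.
Qed.

End TwoPoint.

Section LpNorm.
Variables (R : realType) (d : measure_display) (T : measurableType d).
Variable P : probability T R.
Implicit Types (X Y : T -> R) (a b p : R).

Lemma measurable_powR_norm X p : measurable_fun setT X ->
  measurable_fun setT (fun w => `|X w| `^ p).
Proof.
move=> mX; apply: (@measurableT_comp _ _ _ _ _ _ (@powR R ^~ p)) => //.
exact: measurableT_comp.
Qed.

Lemma norm_LpP X a p : 0 < p -> 0 <= a ->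
  (norm_Lp P p X <= a%:E)%E <->
  (\int[P]_w (`|X w| `^ p)%:E <= (a `^ p)%:E)%E.
Proof.
move=> p0 a0; have pn : p != 0 by rewrite gt_eqF.
have -> : (\int[P]_w (`|X w| `^ p)%:E = norm_Lp P p X `^ p)%E.
  by rewrite /norm_Lp poweR_Lnorm//; apply: eq_integral => w _.
have n0 : (0 <= norm_Lp P p X)%E by exact: Lnorm_ge0.
rewrite -poweR_EFin; split => h.
  by apply: gt0_ler_poweR; rewrite ?in_itv/= ?leey ?andbT ?n0 ?lee_fin ?(ltW p0)//.
have := @gt0_ler_poweR _ p^-1 _ (norm_Lp P p X `^ p)%E (a%:E `^ p)%E.
rewrite -!poweRrM !mulfV// !poweRe1// => h'; apply: h' => //.
- by rewrite invr_ge0 ltW.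
- by rewrite in_itv/= leey andbT ?poweR_ge0 ?lee_fin ?powR_ge0.
- by rewrite in_itv/= leey andbT ?poweR_ge0 ?lee_fin ?powR_ge0.
Qed.

Lemma norm_LpD p X Y a b : 1 <= p ->
  measurable_fun setT X -> measurable_fun setT Y ->
  (norm_Lp P p X <= a%:E)%E -> (norm_Lp P p Y <= b%:E)%E ->
  (norm_Lp P p (fun w => X w + Y w)%R <= (a + b)%:E)%E.
Proof.
move=> p1 mX mY Xa Yb; apply: (le_trans (minkowski_EFin P mX mY p1)).
by rewrite EFinD; exact: leeD.
Qed.

Lemma norm_LpN p X : norm_Lp P p (fun w => - X w) = norm_Lp P p X.
Proof.
rewrite /norm_Lp -(oppe_Lnorm P (EFin \o X)); congr Lnorm.
Qed.

Lemma norm_LpB p X Y a b : 1 <= p ->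
  measurable_fun setT X -> measurable_fun setT Y ->
  (norm_Lp P p X <= a%:E)%E -> (norm_Lp P p Y <= b%:E)%E ->
  (norm_Lp P p (fun w => X w - Y w)%R <= (a + b)%:E)%E.
Proof.
move=> p1 mX mY Xa Yb; apply: norm_LpD => //; last by rewrite norm_LpN.
exact: measurable_funN.
Qed.

Lemma norm_Lp_cst p (c : R) : 0 < p -> norm_Lp P p (fun=> c) = `|c|%:E.
Proof.
move=> p0; rewrite /norm_Lp unlock /=.
rewrite integral_cst// [X in (_ * X)%E](_ : _ = 1%E) ?mule1; last exact: probability_setT.
by rewrite !poweR_EFin -powRrM mulfV ?gt_eqF// powRr1.
Qed.

Lemma norm_Lp_sum p (I : Type) (s : seq I) (F : I -> T -> R) (a : I -> R) : 1 <= p ->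
  (forall i, measurable_fun setT (F i)) ->
  (forall i, (norm_Lp P p (F i) <= (a i)%:E)%E) ->
  (norm_Lp P p (fun w => \sum_(i <- s) F i w)%R <= (\sum_(i <- s) a i)%:E)%E.
Proof.
move=> p1 mF Fa; elim: s => [|i s IH].
  have -> : (fun w => \sum_(i <- [::]) F i w) = fun=> 0.
    by apply/funext => w; rewrite big_nil.
  by rewrite norm_Lp_cst ?normr0 ?big_nil// (lt_le_trans ltr01).
under [X in norm_Lp _ _ X]eq_fun do rewrite big_cons.
rewrite big_cons; apply: norm_LpD => //.
exact: measurable_sum.
Qed.

Lemma norm_LpZ p X c a : 0 < p -> 0 <= a -> measurable_fun setT X ->
  (norm_Lp P p X <= a%:E)%E -> (norm_Lp P p (fun w => c * X w)%R <= (`|c| * a)%:E)%E.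
Proof.
move=> p0 a0 mX /norm_LpP -/(_ p0 a0) h; apply/norm_LpP => //; first by rewrite mulr_ge0.
under eq_integral do rewrite normrM powRM// EFinM.
rewrite ge0_integralZl//.
  by rewrite powRM// EFinM lee_wpmul2l// lee_fin powR_ge0.
exact/measurable_EFinP/measurable_powR_norm.
Qed.

Lemma le_norm_Lp p X Y : 0 < p -> measurable_fun setT X -> measurable_fun setT Y ->
  (forall w, `|X w| <= `|Y w|) -> (norm_Lp P p X <= norm_Lp P p Y)%E.
Proof.
move=> p0 mX mY XY; rewrite /norm_Lp unlock/=.
apply: gt0_ler_poweR; rewrite ?in_itv/= ?leey ?andbT ?invr_ge0 ?(ltW p0)//.
- by rewrite integral_ge0// => w _; exact: poweR_ge0.
- by rewrite integral_ge0// => w _; exact: poweR_ge0.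
apply: ge0_le_integral => //.
- exact/measurable_EFinP/measurable_powR_norm.
- exact/measurable_EFinP/measurable_powR_norm.
- move=> w _; rewrite ?poweR_EFin lee_fin.
  by apply: ge0_ler_powR; rewrite ?nnegrE ?(ltW p0).
Qed.

(** Cauchy-Schwarz, in the form of a weighted arithmetic-geometric
    inequality for |XY|^p. *)
Lemma norm_LpM p X Y a b : 0 < p -> 0 <= a -> 0 <= b ->
  measurable_fun setT X -> measurable_fun setT Y ->
  (norm_Lp P (2 * p) X <= a%:E)%E -> (norm_Lp P (2 * p) Y <= b%:E)%E ->
  (norm_Lp P p (fun w => X w * Y w)%R <= (a * b)%:E)%E.
Proof.
move=> p0 a0 b0 mX mY Xa Yb.
have p20 : 0 < 2 * p by lra.
(* positive bounds are needed for the weights; perturb a and b otherwise *)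
suff main (a' b' : R) : 0 < a' -> 0 < b' -> (norm_Lp P (2 * p) X <= a'%:E)%E ->
    (norm_Lp P (2 * p) Y <= b'%:E)%E ->
    (norm_Lp P p (fun w => X w * Y w)%R <= (a' * b')%:E)%E.
  apply/lee_addgt0Pr => eps eps0.
  pose u := eps / (a + b + 1 + eps).
  have D0 : 0 < a + b + 1 + eps by lra.
  have u0 : 0 < u by rewrite divr_gt0.
  have uE : u * (a + b + 1 + eps) = eps by rewrite /u divfK// gt_eqF.
  have u1 : u <= 1 by rewrite /u ler_pdivrMr//; lra.
  apply: (@le_trans _ _ ((a + u) * (b + u))%:E); last first.
    by rewrite -EFinD lee_fin -uE; nra.
  apply: main; [lra|lra| |].
    by apply: (le_trans Xa); rewrite lee_fin; lra.
  by apply: (le_trans Yb); rewrite lee_fin; lra.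
move=> {a b a0 b0 Xa Yb} a0 b0 /norm_LpP -/(_ p20 (ltW a0)) Xa /norm_LpP -/(_ p20 (ltW b0)) Yb.
apply/norm_LpP => //; first by rewrite mulr_ge0// ltW.
set A := a' `^ p; set B := b' `^ p.
have A0 : 0 < A by rewrite powR_gt0.
have B0 : 0 < B by rewrite powR_gt0.
have dbl (x : R) : 0 <= x -> x `^ (2 * p) = (x `^ p) ^+ 2.
  by move=> x0; rewrite mulrC powRrM powR_mulrn// powR_ge0.
rewrite dbl ?(ltW a0)// -/A in Xa; rewrite dbl ?(ltW b0)// -/B in Yb.
have c1 : 0 <= B / A / 2 by rewrite !mulr_ge0 ?invr_ge0 ?(ltW A0) ?(ltW B0).
have c2 : 0 <= A / B / 2 by rewrite !mulr_ge0 ?invr_ge0 ?(ltW A0) ?(ltW B0).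
apply: (@le_trans _ _ (\int[P]_w ((B / A / 2)%:E * (`|X w| `^ (2 * p))%:E +
    (A / B / 2)%:E * (`|Y w| `^ (2 * p))%:E))%E).
  apply: ge0_le_integral => //.
  - by apply/measurable_EFinP/measurable_powR_norm; exact: measurable_funM.
  - apply: emeasurable_funD; apply: measurable_funeM;
      exact/measurable_EFinP/measurable_powR_norm.
  - move=> w _; rewrite -!EFinM -EFinD lee_fin normrM powRM// !dbl//.
    set x := _ `^ p; set y := _ `^ p.
    have -> : B / A / 2 * x ^+ 2 + A / B / 2 * y ^+ 2 =
      x * y + (B * x - A * y) ^+ 2 / (2 * A * B).
      by field; rewrite !gt_eqF.
    by rewrite lerDl mulr_ge0 ?sqr_ge0// invr_ge0 !mulr_ge0// ltW.
have mm (Z : T -> R) : measurable_fun setT Z ->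
  measurable_fun setT (fun w => (`|Z w| `^ (2 * p))%:E).
  by move=> mZ; exact/measurable_EFinP/measurable_powR_norm.
have pw (Z : T -> R) w : (0 <= (`|Z w| `^ (2 * p))%:E)%E by rewrite lee_fin powR_ge0.
rewrite ge0_integralD//; last 4 first.
- by move=> w _; rewrite mule_ge0.
- by apply: measurable_funeM; exact: mm.
- by move=> w _; rewrite mule_ge0.
- by apply: measurable_funeM; exact: mm.
rewrite !ge0_integralZl//; try exact: mm.
apply: (@le_trans _ _ ((B / A / 2)%:E * (A ^+ 2)%:E + (A / B / 2)%:E * (B ^+ 2)%:E)%E).
  by apply: leeD; apply: lee_wpmul2l.
rewrite -!EFinM -EFinD lee_fin powRM ?(ltW a0) ?(ltW b0)// -/A -/B.
rewrite le_eqVlt; apply/orP; left; apply/eqP.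
by field; rewrite !gt_eqF.
Qed.

(** The squared L^p norm grows additively when a symmetric increment is
    added.  The two-point inequality bounds the average of |X+Y|^p and
    |X-Y|^p, and the triangle inequality in L^(p/2) is applied to X^2 + C Y^2. *)
Lemma norm_Lp_symmetric_step (p C s v : R) X Y : 2 <= p ->
  smoothness_constant p C -> 0 <= s -> 0 <= v -> measurable_fun setT X ->
    measurable_fun setT Y ->
  (norm_Lp P p X <= (Num.sqrt s)%:E)%E -> (norm_Lp P p Y <= (Num.sqrt v)%:E)%E ->
  (\int[P]_w (`|X w + Y w| `^ p)%R%:E = \int[P]_w (`|X w - Y w| `^ p)%R%:E)%E ->
  (norm_Lp P p (fun w => X w + Y w)%R <= (Num.sqrt (s + C * v))%:E)%E.
Proof.
move=> p2 pC s0 v0 mX mY Xs Yv; have C0 := pC.1.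
have p0 : 0 < p by lra.
have p20 : 0 < p / 2 by lra.
have p21 : 1 <= p / 2 by lra.
have sq (y : R) : (`|y ^+ 2|) `^ (p / 2) = `|y| `^ p.
  by rewrite normrX -powR_mulrn// -powRrM mulrC divfK.
have rt (u : R) : 0 <= u -> (Num.sqrt u) `^ p = u `^ (p / 2).
  by move=> u0; rewrite -[in RHS](sqr_sqrtr u0) -powR_mulrn ?sqrtr_ge0// -powRrM mulrC divfK.
have sqr_norm (Z : T -> R) (u : R) : 0 <= u -> (norm_Lp P p Z <= (Num.sqrt u)%:E)%E ->
    (norm_Lp P (p / 2) (fun w => Z w ^+ 2)%R <= u%:E)%E.
  move=> u0 /norm_LpP -/(_ p0 (sqrtr_ge0 _)) h; apply/norm_LpP => //.
  by under eq_integral do rewrite sq; rewrite -rt.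
have sv : 0 <= s + C * v by rewrite addr_ge0// mulr_ge0// ltW.
have mX2 : measurable_fun setT (fun w => X w ^+ 2) by exact: measurable_funX.
have mY2 : measurable_fun setT (fun w => Y w ^+ 2) by exact: measurable_funX.
have mCY : measurable_fun setT (fun w => C * Y w ^+ 2) by exact: measurable_funM.
have mXCY : measurable_fun setT (fun w => X w ^+ 2 + C * Y w ^+ 2).
  exact: measurable_funD.
have mXY : measurable_fun setT (fun w => X w + Y w) by exact: measurable_funD.
have mXY' : measurable_fun setT (fun w => X w - Y w) by exact: measurable_funB.
have h : (norm_Lp P (p / 2) (fun w => X w ^+ 2 + C * Y w ^+ 2)%R
            <= (s + C * v)%:E)%E.
  apply: norm_LpD => //; first exact: sqr_norm.
  by rewrite -{2}(gtr0_norm C0); apply: norm_LpZ => //; exact: sqr_norm.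
move/norm_LpP : h => /(_ p20 sv) h.
have pw (Z : T -> R) (u : R) w : (0 <= (`|Z w| `^ u)%:E)%E.
  by rewrite lee_fin powR_ge0.
have mm (Z : T -> R) (u : R) : measurable_fun setT Z ->
    measurable_fun setT (fun w => (`|Z w| `^ u)%:E).
  by move=> mZ; exact/measurable_EFinP/measurable_powR_norm.
have sum_le : (\int[P]_w (`|X w + Y w| `^ p)%R%:E +
    \int[P]_w (`|X w - Y w| `^ p)%R%:E <=
    2%:E * \int[P]_w (`|X w ^+ 2 + C * Y w ^+ 2| `^ (p / 2))%R%:E)%E.
  rewrite -ge0_integralZl//; last exact: mm.
  rewrite -ge0_integralD//; [|exact: mm|exact: mm].
  apply: ge0_le_integral => //.
  - by move=> w _; rewrite adde_ge0.
  - by apply: emeasurable_funD; exact: mm.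
  - by apply: measurable_funeM; apply: mm.
  - move=> w _; rewrite -EFinM -EFinD lee_fin; apply: (le_trans (pC.2 _ _)).
    by rewrite ler_wpM2l// ger0_norm// addr_ge0 ?sqr_ge0// mulr_ge0 ?sqr_ge0// ltW.
move=> sym; apply/(norm_LpP _ p0 (sqrtr_ge0 _)); rewrite (rt _ sv).
apply: le_trans h; rewrite -(@lee_pmul2l _ 2%:E) ?fin_num_fun ?lte_fin ?ltr0n//.
by rewrite mule_natl mule2n {2}sym.
Qed.

End LpNorm.

(** * Replacing recent innovations by fresh ones *)

Lemma measurable_reindex (R : realType) (I J : choiceType) (sg : J -> I) :
  measurable_fun setT (fun x : product_space R I => ((fun j => x (sg j)) : product_space R J)).
Proof.
by apply: measurable_to_product => j; exact: measurable_coord.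
Qed.

(** A private supply of innovations for each time [t], cut out of the
    copied sequence by a pairing of natural numbers. *)
Definition fresh (t k : nat) : int + int := inr (pickle (t, k))%:Z.

(** Where the past of time t+1 reads its k-th most recent innovation, once
    the [l] most recent ones are replaced by fresh ones.  Times are shifted by
    one because sums below start at 0. *)
Definition mixed (t l k : nat) : int + int :=
  if (k < l)%N then fresh t k else inl (t.+1%:Z - k%:Z).

Lemma fresh_inj t k t' k' : fresh t k = fresh t' k' -> t = t' /\ k = k'.
Proof.
by move=> [] /(pcan_inj (@pickleK _)) [-> ->].
Qed.

Lemma lag_inj (a : int) : injective (fun k : nat => inl (a - k%:Z) : int + int).
Proof. by move=> k k' []; lia. Qed.

Lemma mixed_inj t l : injective (mixed t l).
Proof.
move=> k k'; rewrite /mixed; case: ifP => kl; case: ifP => k'l //.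
  by move/fresh_inj => [].
by move=> []; lia.
Qed.

Section Replacement.
Variables (R : realType) (d : measure_display) (T : measurableType d).
Variables (P : probability T R) (e e' : int -> {RV P >-> R}).
Hypothesis iid : iid_uniform_copies e e'.
Variables (p : R) (h : nat -> product_space R nat -> R).
Hypothesis p2 : 2 <= p.
Let p1 : 1 <= p. Proof. by apply: le_trans p2; rewrite ler1n. Qed.
Let p0 : 0 < p. Proof. exact: lt_le_trans p1. Qed.
Hypothesis mh : forall t, measurable_fun setT (h t).

Local Notation xi := (fun (w : T) (i : int + int) => innovation e e' i w).

Definition increment (t l : nat) (x : product_space R (int + int)%type) : R :=
  h t (fun k => x (mixed t l k)) - h t (fun k => x (mixed t l.+1 k)).

Lemma measurable_reindexed_past t (J : choiceType) (sg : nat -> J) :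
  measurable_fun setT (fun x : product_space R J => h t (fun k => x (sg k))).
Proof.
by apply: (measurableT_comp (mh t)); exact: measurable_reindex.
Qed.

Lemma measurable_increment t l : measurable_fun setT (increment t l).
Proof. by apply: measurable_funB; exact: measurable_reindexed_past. Qed.

Lemma measurable_innovations (J : choiceType) (sg : J -> int + int) :
  measurable_fun setT ((fun w j => innovation e e' (sg j) w) : T -> product_space R J).
Proof. by apply: measurable_to_product => j; exact: measurable_innovation. Qed.

(** Injective reindexing preserves the law. *)
Lemma norm_Lp_reindex (J : choiceType) (sg tau : J -> int + int)
    (F : product_space R J -> R) : injective sg -> injective tau ->
  measurable_fun setT F ->
  norm_Lp P p (fun w => F (fun j => innovation e e' (sg j) w)) =
  norm_Lp P p (fun w => F (fun j => innovation e e' (tau j) w)).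
Proof.
move=> isg itau mF.
have mFp : measurable_fun setT (fun x => `|F x| `^ p).
  apply: (@measurableT_comp _ _ _ _ _ _ (@powR R ^~ p)) => //.
  exact: measurableT_comp.
have E := same_law_integral (fun j => measurable_innovation e e' (sg j))
  (fun j => measurable_innovation e e' (tau j)) (innovation_reindex iid isg itau)
  mFp (fun x => powR_ge0 _ _).
rewrite /norm_Lp unlock.
exact (congr1 (fun z => z `^ p^-1)%E E).
Qed.

Variables (A : R) (delta : nat -> R).
Hypothesis A0 : 0 <= A.
Hypothesis hA : forall t, (norm_Lp P p (fun w => h t (past e 0 w)) <= A%:E)%E.
Hypothesis delta0 : forall l, 0 <= delta l.
Hypothesis deltaA : 2 * A <= delta 0%N.
Hypothesis hdelta : forall t l, (1 <= l)%N ->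
  (norm_Lp P p (fun w => h t (past e t.+1%:Z w) -
     h t (coupled_past e e' t.+1%:Z (t.+1%:Z - l%:Z) w))%R <= (delta l)%:E)%E.

Lemma norm_Lp_reindexed_past t (sg : nat -> int + int) : injective sg ->
  (norm_Lp P p (fun w => h t (fun k => innovation e e' (sg k) w)) <= A%:E)%E.
Proof.
move=> isg.
by rewrite (norm_Lp_reindex isg (@lag_inj 0)).
Qed.

(** For positive lags, the pair of arguments of [h t] in the increment has
    the law of the past and of the past with one innovation replaced; both are
    functions of one sequence indexed by [option nat], where [None] is the
    replacement.  Lag 0 falls under the triangle inequality. *)
Lemma norm_Lp_increment t l :
  (norm_Lp P p (fun w => increment t l (xi w)) <= (delta l)%:E)%E.
Proof.
case: l => [|l].
  apply: (@le_trans _ _ (A + A)%:E);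
    last by rewrite lee_fin (le_trans _ deltaA)// mulr_natl mulr2n.
  apply: norm_LpB => //.
  - exact: (measurableT_comp (mh t) (measurable_innovations _)).
  - exact: (measurableT_comp (mh t) (measurable_innovations _)).
  - by apply: norm_Lp_reindexed_past; exact: mixed_inj.
  - by apply: norm_Lp_reindexed_past; exact: mixed_inj.
pose F (y : product_space R (option nat)) := h t (fun k => y (Some k)) -
   h t (fun k => y (if k == l.+1 then None else Some k)).
pose sg (j : option nat) := if j is Some k then mixed t l.+1 k else fresh t l.+1.
pose tau (j : option nat) : int + int :=
  if j is Some k then inl (t.+1%:Z - k%:Z) else inr (t.+1%:Z - l.+1%:Z).
have -> : (fun w => increment t l.+1 (xi w)) = (fun w => F (fun j => innovation e e' (sg j) w)).
  apply/funext => w; rewrite /increment /F; congr (_ - h t _).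
  apply/funext => k; congr (innovation _ _ _ _); rewrite /sg /mixed.
  by case: eqP => [->|kl]; [rewrite ltnSn|rewrite ltnS leq_eqVlt; move/eqP/negbTE: kl => ->].
have isg : injective sg.
  move=> [k|] [k'|] //=.
  - by move/mixed_inj => ->.
  - by rewrite /mixed; case: ifP => // kl /fresh_inj [_ kl']; move: kl; rewrite kl' ltnn.
  - by rewrite /mixed; case: ifP => // kl /fresh_inj [_ kl']; move: kl; rewrite -kl' ltnn.
have itau : injective tau.
  by move=> [k|] [k'|] //= [] ?; congr Some; lia.
rewrite (norm_Lp_reindex isg itau); last first.
  by apply: measurable_funB; exact: measurable_reindexed_past.
apply: le_trans (hdelta t (isT : (1 <= l.+1)%N)).
rewrite le_eqVlt; apply/orP; left; apply/eqP; congr norm_Lp.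
apply/funext => w; rewrite /F; congr (_ - h t _).
apply/funext => k; rewrite /coupled_past /tau.
have -> : (t.+1%:Z - k%:Z == t.+1%:Z - l.+1%:Z) = (k == l.+1) by lia.
by case: ifP.
Qed.

(** The symmetry of the innovations that changes the sign of
    [increment t l]. *)
Definition exchange (t l : nat) (i : int + int) : int + int :=
  if i == inl (t.+1%:Z - l%:Z) then fresh t l
  else if i == fresh t l then inl (t.+1%:Z - l%:Z) else i.

Lemma exchangeK t l : involutive (exchange t l).
Proof.
move=> i; rewrite /exchange; have [->|n1] := eqVneq i (inl _).
  by rewrite eqxx.
have [->|n2] := eqVneq i (fresh t l); first by rewrite eqxx.
by rewrite (negbTE n1) (negbTE n2).
Qed.

Lemma exchange_mixed t l k : exchange t l (mixed t l k) = mixed t l.+1 k.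
Proof.
rewrite /exchange /mixed (ltnS k l); case: (ltngtP k l) => kl /=.
- by case: eqP => // /fresh_inj [_ kl']; move: kl; rewrite kl' ltnn.
- case: eqP => // -[]; lia.
- by rewrite kl eqxx.
Qed.

Lemma increment_exchange t l x :
  increment t l (fun i => x (exchange t l i)) = - increment t l x.
Proof.
rewrite /increment opprB; congr (h t _ - h t _); apply/funext => k.
  by rewrite exchange_mixed.
by rewrite -exchange_mixed exchangeK.
Qed.

(** The innovation at lag [l] of the later time comes after every
    unreplaced innovation read by the earlier increment, and the fresh
    innovations of different times are disjoint. *)
Lemma increment_exchange_past s t l x : (s < t)%N ->
  increment s l (fun i => x (exchange t l i)) = increment s l x.
Proof.
move=> st.
have key l' k : (l <= l' <= l.+1)%N -> exchange t l (mixed s l' k) = mixed s l' k.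
  move=> ll'; rewrite /exchange /mixed; case: (ltnP k l') => kl /=.
    by case: eqP => // /fresh_inj [ts _]; move: st; rewrite ts ltnn.
  by case: eqP => // -[]; lia.
rewrite /increment; congr (h s _ - h s _); apply/funext => k; rewrite key//; lia.
Qed.

(** Induction on the number of terms: the exchange at the last time fixes
    the earlier terms and changes the sign of the last one, so that
    [norm_Lp_symmetric_step] applies. *)
Lemma norm_Lp_increment_sum (C : R) (n l : nat) : smoothness_constant p C ->
  (norm_Lp P p (fun w => \sum_(t < n) increment t l (xi w))%R
     <= (Num.sqrt (n%:R * (C * delta l ^+ 2)))%:E)%E.
Proof.
move=> pC; have C0 := pC.1.
have mI (t : nat) : measurable_fun setT (fun w => increment t l (xi w)).
  exact: (measurableT_comp (measurable_increment t l) (measurable_innovations id)).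
elim: n => [|n IH].
  rewrite mul0r sqrtr0 (_ : (fun w => _) = fun=> 0).
    by rewrite norm_Lp_cst ?normr0.
  by apply/funext => w; rewrite big_ord0.
under [X in norm_Lp _ _ X]eq_fun do rewrite big_ord_recr/=.
rewrite -addn1 natrD mulrDl mul1r.
apply: (norm_Lp_symmetric_step p2 pC _ _ _ (mI n) IH).
- by rewrite mulr_ge0// mulr_ge0 ?sqr_ge0// ltW.
- exact: sqr_ge0.
- by apply: measurable_sum => t; exact: mI.
- by rewrite sqrtr_sqr ger0_norm//; exact: norm_Lp_increment.
pose F (x : product_space R (int + int)%type) :=
  `|\sum_(t < n) increment t l x + increment n l x| `^ p.
have -> : (\int[P]_w (`|\sum_(t < n) increment t l (xi w) - increment n l (xi w)| `^ p)%:E =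
   \int[P]_w (F (fun i => innovation e e' (exchange n l i) w))%:E)%E.
  apply: eq_integral => w _; congr (_ `^ _)%:E; congr `|_ + _|.
    by apply: eq_bigr => t _; rewrite (increment_exchange_past l (xi w) (ltn_ord t)).
  by rewrite (increment_exchange _ _ (xi w)).
apply: (@same_law_integral _ _ _ _ _ _ _ _ (fun w i => innovation e e' i w) _ F).
- by move=> j; exact: measurable_innovation.
- by move=> j; exact: measurable_innovation.
- apply: (@innovation_reindex _ _ _ _ _ _ iid _ id) => //.
  exact: inv_inj (exchangeK n l).
- apply: (@measurableT_comp _ _ _ _ _ _ (@powR R ^~ p)) => //.
  apply: measurableT_comp => //; apply: measurable_funD; last exact: measurable_increment.
  by apply: measurable_sum => t; exact: measurable_increment.
- by move=> x; exact: powR_ge0.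
Qed.

Definition replaced_sum (n N : nat) (w : T) : R :=
  \sum_(t < n) h t (fun k => xi w (mixed t N k)).

(** The increments telescope. *)
Lemma replaced_sumB n N w : replaced_sum n 0 w - replaced_sum n N w =
  \sum_(l < N) \sum_(t < n) increment t l (xi w).
Proof.
elim: N => [|N IH]; first by rewrite big_ord0 subrr.
rewrite big_ord_recr/= -IH /increment sumrB -/(replaced_sum n N w) -/(replaced_sum n N.+1 w).
by rewrite addrA subrK.
Qed.

Lemma measurable_replaced_sum n N : measurable_fun setT (replaced_sum n N).
Proof.
apply: measurable_sum => t.
exact: (measurableT_comp (mh t) (measurable_innovations _)).
Qed.

Lemma norm_Lp_replaced_sum (C D : R) (n N : nat) : smoothness_constant p C ->
  \sum_(l < N) delta l <= D ->
  (norm_Lp P p (fun w => replaced_sum n 0 w - replaced_sum n N w)%R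
     <= (Num.sqrt (n%:R * C) * D)%:E)%E.
Proof.
move=> pC dD; have C0 := pC.1.
have -> : (fun w => replaced_sum n 0 w - replaced_sum n N w) =
  (fun w => \sum_(l < N) \sum_(t < n) increment t l (xi w)).
  by apply/funext => w; exact: replaced_sumB.
apply: (@le_trans _ _ (\sum_(l < N) Num.sqrt (n%:R * C) * delta l)%:E).
  apply: norm_Lp_sum => [//|l|l].
    apply: measurable_sum => t.
    exact: (measurableT_comp (measurable_increment t l) (measurable_innovations id)).
  apply: (le_trans (norm_Lp_increment_sum n l pC)).
  rewrite lee_fin mulrA sqrtrM ?mulr_ge0 ?(ltW C0)//.
  by rewrite sqrtr_sqr ger0_norm.
by rewrite lee_fin -mulr_sumr ler_wpM2l// sqrtr_ge0.
Qed.

End Replacement.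

(** * Convergence in probability of the replaced process *)

Lemma measurable_superlevel (R : realType) d (T : measurableType d) (f : T -> R) (c : R) :
  measurable_fun setT f -> measurable [set w | c < f w].
Proof.
move=> mf; have -> : [set w | c < f w] = setT `&` f @^-1` `]c, +oo[%classic.
  by rewrite setTI; apply/seteqP; split => w /=; rewrite in_itv/= andbT.
exact: mf.
Qed.

Section EventuallyEqual.
Variables (R : realType) (d : measure_display) (T : measurableType d).
Variable P : probability T R.
Variables (UN : nat -> T -> nat -> R) (U : T -> nat -> R).
Hypothesis mUN : forall N k, measurable_fun setT (fun w => UN N w k).
Hypothesis mU : forall k, measurable_fun setT (fun w => U w k).
Hypothesis law : forall N, same_law P P (UN N) U.
Hypothesis ev : forall N k w, (k < N)%N -> UN N w k = U w k.

Let symdiff N (A : set (product_space R nat)) : set T :=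
  (UN N @^-1` A `\` U @^-1` A) `|` (U @^-1` A `\` UN N @^-1` A).

Lemma measurable_preU (A : set (product_space R nat)) : measurable A -> measurable (U @^-1` A).
Proof.
move=> mA; rewrite -[X in measurable X]setTI.
have mU' : measurable_fun setT (U : T -> product_space R nat) by exact: measurable_to_product.
exact: mU'.
Qed.

Lemma measurable_preUN N (A : set (product_space R nat)) : measurable A ->
  measurable (UN N @^-1` A).
Proof.
move=> mA; rewrite -[X in measurable X]setTI.
have mU' : measurable_fun setT (UN N : T -> product_space R nat).
  by exact: measurable_to_product.
exact: mU'.
Qed.

Let measurable_symdiff N A : measurable A -> measurable (symdiff N A).
Proof.
by move=> mA; apply: measurableU; apply: measurableD;
  solve [exact: measurable_preU|exact: measurable_preUN].
Qed.

Let good : set (set (product_space R nat)) := [set A | measurable A /\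
  forall eta : R, 0 < eta -> exists N0, forall N, (N0 <= N)%N -> (P (symdiff N A) <= eta%:E)%E].

Let good_bigcup_ord (F : nat -> set (product_space R nat)) n :
  (forall i, good (F i)) -> good (\big[setU/set0]_(i < n) F i).
Proof.
move=> gF; split; first by apply: bigsetU_measurable => i _; exact: (gF i).1.
elim: n => [|n IH] eta eta0.
  exists 0%N => N _; rewrite big_ord0 /symdiff !preimage_set0 !setD0 setU0 measure0
    lee_fin ltW//.
have [|N1 h1] := IH (eta / 2); first by rewrite divr_gt0.
have [|N2 h2] := (gF n).2 (eta / 2); first by rewrite divr_gt0.
exists (maxn N1 N2) => N; rewrite geq_max => /andP[hN1 hN2].
have mB : measurable (\big[setU/set0]_(i < n) F i).
  by apply: bigsetU_measurable => i _; exact: (gF i).1.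
have mF := (gF n).1.
apply: (@le_trans _ _ (P (symdiff N (\big[setU/set0]_(i < n) F i) `|` symdiff N (F n)))).
  apply: le_measure; rewrite ?inE.
  - by apply: measurable_symdiff; rewrite big_ord_recr/=; exact: measurableU.
  - by apply: measurableU; exact: measurable_symdiff.
  - rewrite big_ord_recr/= /symdiff !preimage_setU => w /=.
    by rewrite /setU /setD /=; tauto.
apply: (le_trans (measureU2 _ _ _)); [exact: measurable_symdiff|exact: measurable_symdiff|].
by rewrite (splitr eta) EFinD; apply: leeD; [exact: h1|exact: h2].
Qed.

(** The sets with this property contain the cylinders and form a
    sigma-algebra.  For a countable union, a finite subunion carries all but a
    small part of its mass; this part is equally small for [UN N] and [U],
    which have the same law. *)
Lemma preimage_symdiff_cvg0 (A : set (product_space R nat)) (eta : R) :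
  measurable A -> 0 < eta ->
  exists N0, forall N, (N0 <= N)%N -> (P (symdiff N A) <= eta%:E)%E.
Proof.
move=> mA eta0; suff : good A by case=> _; exact.
have : <<s @coord_cylinders R nat >> A by [].
move: A {mA}; apply: smallest_sub; last first.
  move=> _ [k [B [mB ->]]]; split.
    by rewrite -[X in measurable X]setTI; exact: measurable_coord.
  move=> z z0; exists k.+1 => N kN.
  rewrite (_ : symdiff _ _ = set0) ?measure0 ?lee_fin ?ltW//.
  by apply/seteqP; split => // w; rewrite /symdiff /setU /setD /= ev//; tauto.
split.
- split; first exact: measurable0.
  by move=> z z0; exists 0%N => N _;
    rewrite /symdiff !preimage_set0 !setD0 setU0 measure0 lee_fin ltW.
- move=> A [mA gA]; split; first exact: measurableD.
  move=> z z0; have [N0 h] := gA _ z0; exists N0 => N /h.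
  rewrite (_ : symdiff N (setT `\` A) = symdiff N A)//.
  apply/seteqP; split => w; rewrite /symdiff /setU /setD /=; last by tauto.
  by move=> [[h1 h2]|[h1 h2]]; [right|left]; split; try tauto;
    apply: contrapT; tauto.
- move=> F0 gF0; pose F : nat -> set (product_space R nat) := F0.
  have gF i : good (F i) by exact: gF0.
  pose FU : set (product_space R nat) := \bigcup_i F i.
  have mFU : measurable FU by apply: bigcupT_measurable => i; exact: (gF i).1.
  change (good FU); split => // z z0.
  pose B n : set (product_space R nat) := \big[setU/set0]_(i < n) F i.
  have mB n : measurable (B n) by apply: bigsetU_measurable => i _; exact: (gF i).1.
  have BU n : B n `<=` FU.
    by rewrite /B -bigcup_mkord => x [i _ Fx]; exists i.
  have [n hn] : exists n, (P (U @^-1` (FU `\` B n)) <= (z / 4)%:E)%E.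
    have c : P (U @^-1` (FU `\` B n)) @[n --> \oo] --> 0%E.
      rewrite -(measure0 P) (_ : set0 = \bigcap_n (U @^-1` (FU `\` B n))).
        apply: nonincreasing_cvg_mu.
        - by rewrite ltey_eq fin_num_measure//; apply: measurable_preU; exact: measurableD.
        - by move=> n; apply: measurable_preU; exact: measurableD.
        - by apply: bigcapT_measurable => n; apply: measurable_preU; exact: measurableD.
        - move=> a b ab; apply/subsetPset => w [/= h1 h2]; split => // h3; apply: h2.
          by move: h3; rewrite /B -!bigcup_mkord => -[i /= ia Fi]; exists i => //=;
            exact: leq_trans ab.
      apply/seteqP; split => // w h.
      have [[i _ Fi] _] := h 0%N I.
      have [_] := h i.+1 I; apply.
      by rewrite /B -bigcup_mkord; exists i => /=.
    have /fine_cvgP[fin] := c.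
    have z4 : 0 < z / 4 by lra.
    move/cvgrPdist_le => /(_ _ z4) [n _ /(_ n (leqnn n))] /= hn.
    exists n; rewrite -(@fineK _ (P _)); last first.
      by rewrite fin_num_measure//; apply: measurable_preU; exact: measurableD.
    by rewrite lee_fin; move: hn; rewrite sub0r normrN ger0_norm// fine_ge0.
  have z2 : 0 < z / 2 by lra.
  have [N0 h0] := (good_bigcup_ord n gF).2 _ z2.
  exists N0 => N /h0 hN.
  have mD : measurable (FU `\` B n) by exact: measurableD.
  apply: (@le_trans _ _ (P (symdiff N (B n) `|` (U @^-1` (FU `\` B n) `|`
     UN N @^-1` (FU `\` B n))))).
    apply: le_measure; rewrite ?inE.
    - exact: measurable_symdiff.
    - apply: measurableU; first exact: measurable_symdiff.
      by apply: measurableU; [exact: measurable_preU|exact: measurable_preUN].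
    - move=> w; have := BU n (U w); have := BU n (UN N w).
      rewrite /symdiff /setU /setD /=.
      move=> h1 h2.
      have [?|?] := pselect (B n (U w)); have [?|?] := pselect (B n (UN N w)); tauto.
  apply: (le_trans (measureU2 _ _ _)); [exact: measurable_symdiff| |].
    by apply: measurableU; [exact: measurable_preU|exact: measurable_preUN].
  have -> : z = z / 2 + (z / 4 + z / 4) by lra.
  rewrite EFinD; apply: leeD => //.
  apply: (le_trans (measureU2 _ _ _)); [exact: measurable_preU|exact: measurable_preUN|].
  rewrite EFinD; apply: leeD => //.
  apply: le_trans hn; rewrite le_eqVlt; apply/orP; left; apply/eqP.
  exact: law N _ mD.
Qed.

(** Unless |h U| is large, a gap of more than [eta] between [h (UN N)] and
    [h U] encloses one of finitely many levels [c i] of a grid of mesh eta/2,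
    so that [UN N] and [U] lie on different sides of a superlevel set. *)
Lemma reindexed_cvg_probability (h : product_space R nat -> R) (eta : R) :
  measurable_fun setT h -> 0 < eta ->
  exists N0, forall N, (N0 <= N)%N ->
    (P [set w | (eta < `|h (UN N w) - h (U w)|)%R] <= eta%:E)%E.
Proof.
move=> mh eta0.
have mhU : measurable_fun setT (fun w => h (U w)).
  by apply: (measurableT_comp mh); exact: measurable_to_product.
have mhUN N : measurable_fun setT (fun w => h (UN N w)).
  by apply: (measurableT_comp mh); exact: measurable_to_product.
have [M hM] : exists M : nat, (P [set w | (M%:R < `|h (U w)|)%R] <= (eta / 2)%:E)%E.
  have mb n : measurable [set w | n%:R < `|h (U w)|].
    by apply: measurable_superlevel; exact: measurableT_comp.
  have c : P [set w | n%:R < `|h (U w)|] @[n --> \oo] --> 0%E.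
    rewrite -(measure0 P) (_ : set0 = \bigcap_n [set w | n%:R < `|h (U w)|]).
      apply: nonincreasing_cvg_mu => //.
      - by rewrite ltey_eq fin_num_measure.
      - by apply: bigcapT_measurable.
      - move=> a b ab; apply/subsetPset => w /=; apply: le_lt_trans.
        by rewrite ler_nat.
    apply/seteqP; split => // w /(_ (Num.bound `|h (U w)|) I) /=.
    by have := archi_boundP (normr_ge0 (h (U w))) => /ltW; rewrite leNgt => /negP.
  have /fine_cvgP[fin] := c.
  have z4 : 0 < eta / 2 by lra.
  move/cvgrPdist_le => /(_ _ z4) [n _ /(_ n (leqnn n))] /= hn.
  exists n; rewrite -(@fineK _ (P _)); last by rewrite fin_num_measure.
  by rewrite lee_fin; move: hn; rewrite sub0r normrN ger0_norm// fine_ge0.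
have eta20 : 0 < eta / 2 by lra.
pose K := (Num.bound (M%:R / (eta / 2))).+1.
pose c (i : nat) : R := (i%:R - K%:R) * (eta / 2).
pose A (i : nat) : set (product_space R nat) := [set x | c i < h x].
have mA i : measurable (A i).
  exact: measurable_superlevel.
pose n := (K + K).+1.
have n0 : 0 < eta / 2 / n%:R by rewrite !divr_gt0// ltr0n.
have unif (k : nat) (z : R) : 0 < z -> exists N0, forall N, (N0 <= N)%N ->
    forall i, (i < k)%N -> (P (symdiff N (A i)) <= z%:E)%E.
  move=> z0; elim: k => [|k [N1 h1]]; first by exists 0%N.
  have [N2 h2] := preimage_symdiff_cvg0 (mA k) z0.
  exists (maxn N1 N2) => N; rewrite geq_max => /andP[hN1 hN2] i.
  by rewrite ltnS leq_eqVlt => /predU1P[->|]; [exact: h2|exact: h1].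
have [N0 hN0] := unif n _ n0.
exists N0 => N hN.
apply: (@le_trans _ _ (P ([set w | (M%:R < `|h (U w)|)%R] `|`
  \big[setU/set0]_(i < n) symdiff N (A i)))).
  apply: le_measure; rewrite ?inE.
  - by apply: measurable_superlevel; apply: measurableT_comp => //; exact: measurable_funB.
  - apply: measurableU; first by apply: measurable_superlevel; exact: measurableT_comp.
    by apply: bigsetU_measurable => i _; exact: measurable_symdiff.
  - move=> w /= hw; have [hMw|hMw] := ltP M%:R `|h (U w)|; [by left|right].
    suff : (\bigcup_(i < n) symdiff N (A i)) w by rewrite bigcup_mkord.
    have hKM : `|h (U w) / (eta / 2)| < K%:R - 1.
      rewrite normrM (gtr0_norm (_ : 0 < (eta / 2)^-1)) ?invr_gt0//.
      have -> : K%:R - 1 = (Num.bound (M%:R / (eta / 2)))%:R :> R.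
        by rewrite /K -[_.+1]addn1 natrD addrK.
      apply: (@le_lt_trans _ _ (M%:R / (eta / 2))).
        by rewrite ler_wpM2r// invr_ge0 ltW.
      by apply: archi_boundP; rewrite divr_ge0 ?ler0n// ltW.
    pose x := h (U w) / (eta / 2) + K%:R.
    have hx : h (U w) = (x - K%:R) * (eta / 2) by rewrite /x addrK divfK// gt_eqF.
    have x1 : 1 < x by move: hKM; rewrite ltr_norml /x; lra.
    have x2 : x < K%:R + K%:R - 1 by move: hKM; rewrite ltr_norml /x; lra.
    have /truncn_itv/andP[t1 t2] : 0 <= x by lra.
    set t := Num.truncn x in t1 t2.
    rewrite -[t.+1]addn1 natrD in t2.
    have t0 : (0 < t)%N by rewrite -(@ltr0n R); lra.
    have tn : (t.+1 < n)%N.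
      rewrite /n ltnS -(ltr_nat R) natrD.
      by apply: le_lt_trans t1 _; lra.
    move: hw; rewrite ltr_normr => /orP[hw|hw].
      exists t.+1 => //=; left; split; rewrite /A /= /c.
        by move: hw; rewrite -[t.+1]addn1 natrD hx; nra.
      by apply/negP; rewrite -leNgt -[t.+1]addn1 natrD hx; nra.
    exists t.-1 => /=; first by rewrite (leq_ltn_trans (leq_pred _))// (leq_trans _ tn).
    have tE : t%:R = t.-1%:R + 1 :> R by rewrite natr1 prednK.
    right; split; rewrite /A /= /c.
      by rewrite hx; nra.
    by apply/negP; rewrite -leNgt; move: hw; rewrite hx; nra.
apply: (le_trans (measureU2 _ _ _)).
- by apply: measurable_superlevel; exact: measurableT_comp.
- by apply: bigsetU_measurable => i _; exact: measurable_symdiff.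
rewrite (splitr eta) EFinD; apply: leeD => //.
apply: (@le_trans _ _ (\sum_(i < n) P (symdiff N (A i)))%E).
  by apply: (@Boole_inequality _ _ _ P (fun i => symdiff N (A i))) => i _;
    exact: measurable_symdiff.
apply: (@le_trans _ _ (\sum_(i < n) (eta / 2 / n%:R)%:E)%E).
  by apply: lee_sum => i _; exact: hN0.
rewrite sumEFin sumr_const card_ord -(mulr_natr (_ / _)) divfK//.
by rewrite pnatr_eq0.
Qed.

End EventuallyEqual.

(** * Limits and Jensen inequality in L^p *)

Section Limits.
Variables (R : realType) (d : measure_display) (T : measurableType d).
Variable P : probability T R.

(** Monotone convergence. *)
Lemma norm_Lp_truncated (Z : T -> R) (p B : R) : 1 <= p -> 0 <= B ->
  measurable_fun setT Z ->
  (forall M : nat, (norm_Lp P p (fun w => Num.min `|Z w| M%:R)%R <= B%:E)%E) ->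
  (norm_Lp P p Z <= B%:E)%E.
Proof.
move=> p1 B0 mZ h; have p0 : 0 < p by lra.
have mM (M : nat) : measurable_fun setT (fun w => Num.min `|Z w| M%:R).
  by apply: measurable_minr => //; exact: measurableT_comp.
have M0 (M : nat) w : 0 <= Num.min `|Z w| M%:R by rewrite le_min normr_ge0 ler0n.
apply/norm_LpP => //.
pose g (M : nat) (w : T) := (`|Num.min `|Z w| M%:R| `^ p)%:E.
have c : (\int[P]_w g M w)%E @[M --> \oo] --> (\int[P]_w (`|Z w| `^ p)%:E)%E.
  have gZ w : (g M w)%E @[M --> \oo] --> (`|Z w| `^ p)%:E.
    apply: cvg_near_cst; exists (Num.bound `|Z w|) => // M /= bM.
    rewrite /g (ger0_norm (M0 _ _)) min_l//.
    have := archi_boundP (normr_ge0 (Z w)) => /ltW /le_trans; apply.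
    by rewrite ler_nat.
  under [X in _ --> X]eq_integral => w _ do rewrite -(cvg_lim _ (gZ w))//.
  apply: cvg_monotone_convergence => //.
  - by move=> M; apply/measurable_EFinP/measurable_powR_norm.
  - by move=> M w _; rewrite lee_fin powR_ge0.
  - move=> w _ M N MN; rewrite lee_fin; apply: ge0_ler_powR; rewrite ?nnegrE ?(ltW p0)//.
    by rewrite !(ger0_norm (M0 _ _)) le_min ge_min lexx/= ge_min ler_nat MN orbT.
have <- := cvg_lim _ c => //.
apply: lime_le; first by apply/cvg_ex; eexists; exact: c.
by apply: nearW => M; apply/norm_LpP.
Qed.

(** Fatou's lemma along convergence in probability, with a factor 2 in
    place of a passage to a subsequence: truncate [Z] at level [m] and pay [m]
    on the exceptional event. *)
Lemma norm_Lp_limit (ZN : nat -> T -> R) (Z : T -> R) (p B : R) : 1 <= p -> 0 < B ->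
  measurable_fun setT Z -> (forall N, measurable_fun setT (ZN N)) ->
  (forall N, (norm_Lp P p (ZN N) <= B%:E)%E) ->
  (forall eta : R, 0 < eta -> exists N,
     (P [set w | (eta < `|ZN N w - Z w|)%R] <= eta%:E)%E) ->
  (norm_Lp P p Z <= (2 * B)%:E)%E.
Proof.
move=> p1 B0 mZ mZN hZN cvg; have p0 : 0 < p by lra.
apply: norm_Lp_truncated => //; first by rewrite mulr_ge0// ltW.
case=> [|M].
  rewrite (_ : (fun w => _) = fun=> 0).
    by rewrite norm_Lp_cst// normr0 lee_fin mulr_ge0// ltW.
  by apply/funext => w; rewrite mulr0n min_r.
pose m : R := M.+1%:R.
have m0 : 0 < m by rewrite ltr0n.
(* eta is chosen so that eta + m * eta `^ p^-1 <= B *)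
pose eta := Num.min (B / 2) ((B / 2 / m) `^ p).
have Bm : 0 < B / 2 / m by rewrite !divr_gt0.
have eta0 : 0 < eta by rewrite lt_min powR_gt0// divr_gt0.
have [N hN] := cvg _ eta0.
pose bad := [set w | (eta < `|ZN N w - Z w|)%R].
have mbad : measurable bad.
  by apply: measurable_superlevel; apply: measurableT_comp => //; exact: measurable_funB.
have mind : measurable_fun setT (\1_bad : T -> R) by exact: measurable_indic.
have nind : (norm_Lp P p (\1_bad : T -> R) <= (B / 2 / m)%:E)%E.
  apply/norm_LpP; rewrite ?(ltW Bm)//.
  under eq_integral => w _.
    rewrite (_ : `|\1_bad w| `^ p = \1_bad w :> R); last first.
      by rewrite indicE; case: (_ \in _); rewrite ?normr1 ?powR1 ?normr0 ?powR0 ?gt_eqF.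
    over.
  rewrite integral_indic// setIT; apply: (le_trans hN).
  by rewrite lee_fin ge_min lexx orbT.
have mZN' : measurable_fun setT (fun w => `|ZN N w|) by exact: measurableT_comp.
have mmi : measurable_fun setT (fun w => m * (\1_bad w : R)) by exact: measurable_funM.
have mei : measurable_fun setT (fun w => eta + m * (\1_bad w : R)) by exact: measurable_funD.
apply: (@le_trans _ _ (norm_Lp P p (fun w => `|ZN N w| + (eta + m * \1_bad w))%R)).
  apply: le_norm_Lp => //.
  - by apply: measurable_minr => //; exact: measurableT_comp.
  - exact: measurable_funD.
  - move=> w; have q0 : 0 <= Num.min `|Z w| M.+1%:R by rewrite le_min normr_ge0 ler0n.
    rewrite (ger0_norm q0); apply: (le_trans _ (ler_norm _)).
    have [hb|hb] := pselect (bad w).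
      rewrite indicE mem_set// mulr1 ge_min.
      by apply/orP; right; rewrite addrA lerDr addr_ge0// ltW.
    rewrite indicE memNset// mulr0 addr0 ge_min; apply/orP; left.
    move/negP : hb; rewrite -leNgt => hb.
    have := ler_normD (Z w - ZN N w) (ZN N w).
    by rewrite subrK (distrC (Z w)); lra.
apply: (@le_trans _ _ (B + (B / 2 + m * (B / 2 / m)))%:E).
  apply: norm_LpD => //.
    by apply: le_trans (hZN N); apply: le_norm_Lp => // w; rewrite normr_id.
  apply: norm_LpD => //.
    by rewrite norm_Lp_cst// lee_fin gtr0_norm// ge_min lexx.
  rewrite -{2}(gtr0_norm m0); apply: norm_LpZ => //; exact: ltW.
rewrite lee_fin (mulrC m) divfK ?gt_eqF//; lra.
Qed.

Lemma norm_Lp1_le (X : T -> R) (p : R) : 1 <= p -> measurable_fun setT X ->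
  (\int[P]_w `|X w|%:E <= norm_Lp P p X)%E.
Proof.
move=> p1 mX; have E1 : (\int[P]_w `|X w|%:E = norm_Lp P 1 X)%E.
  by rewrite /norm_Lp Lnorm1; apply: eq_integral => w _.
have [->|pn1] := eqVneq p 1; first by rewrite E1.
have p1' : 1 < p by rewrite lt_neqAle eq_sym pn1.
pose q := p / (p - 1).
have q0 : 0 < q by rewrite divr_gt0//; lra.
have p0 : 0 < p by lra.
have pq : p^-1 + q^-1 = 1.
  by rewrite /q; field; rewrite !gt_eqF//; lra.
have := @hoelder _ _ _ P X (cst 1) p q mX (measurable_cst _) p0 q0 pq.
rewrite -[X in (_ <= _ * X)%E]/(norm_Lp P q (fun=> 1)) norm_Lp_cst// normr1 mule1.
apply: le_trans; rewrite E1 /norm_Lp le_eqVlt; apply/orP; left; apply/eqP.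
by congr Lnorm; apply/funext => w /=; rewrite mulr1.
Qed.

Lemma norm_Lp_integrable (X : T -> R) (p a : R) : 1 <= p -> measurable_fun setT X ->
  (norm_Lp P p X <= a%:E)%E -> P.-integrable setT (EFin \o X).
Proof.
move=> p1 mX Xa; apply/integrableP; split; first exact/measurable_EFinP.
by apply: (le_lt_trans (norm_Lp1_le p1 mX)); rewrite (le_lt_trans Xa)// ltry.
Qed.

(** |a - EX| <= E|a - X|, which is at most the L^p norm of a - X. *)
Lemma jensen_norm (X : T -> R) (p a : R) : 1 <= p -> measurable_fun setT X ->
  P.-integrable setT (EFin \o X) ->
  ((`|a - fine 'E_P[X]| `^ p)%:E <= \int[P]_w (`|a - X w| `^ p)%:E)%E.
Proof.
move=> p1 mX iX; have p0 : 0 < p by lra.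
have maX : measurable_fun setT (fun w => a - X w) by exact: measurable_funB.
have intE : (\int[P]_w (`|a - X w| `^ p)%:E = norm_Lp P p (fun w => a - X w)%R `^ p)%E.
  by rewrite /norm_Lp poweR_Lnorm ?gt_eqF//; apply: eq_integral => w _.
have [foo|fin] := eqVneq (norm_Lp P p (fun w => a - X w)%R) +oo%E.
  by rewrite intE foo poweRyr ?gt_eqF// leey.
have EX : (`|a - fine 'E_P[X]|%:E <= norm_Lp P p (fun w => a - X w)%R)%E.
  apply: le_trans (norm_Lp1_le p1 maX).
  have EXi : ('E_P[X] = \int[P]_w (X w)%:E)%E by rewrite unlock.
  have ia : P.-integrable setT (EFin \o cst a) by exact: finite_measure_integrable_cst.
  have iaX : P.-integrable setT (fun w => (a - X w)%:E).
    by apply: eq_integrable (integrableB measurableT ia iX).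
  have IaX : (\int[P]_w (a - X w)%:E = (a - fine 'E_P[X])%:E)%E.
    rewrite (_ : (\int[P]_w (a - X w)%:E =
      \int[P]_w ((EFin \o cst a) w - (EFin \o X) w))%E); last first.
      exact: eq_integral.
    rewrite integralB// EFinB fineK; last by rewrite EXi integrable_fin_num.
    rewrite EXi; congr (_ - _)%E.
    have := @integral_cst _ _ _ P setT measurableT a%:E; rewrite /cst/= => ->.
    by rewrite [X in (_ * X)%E](_ : _ = 1%E) ?mule1//; exact: probability_setT.
  rewrite -abse_EFin -IaX.
  by apply: le_abse_integral => //; exact/measurable_EFinP.
set b := fine (norm_Lp P p (fun w => a - X w)%R).
have bE : (norm_Lp P p (fun w => a - X w)%R = b%:E)%E.
  by rewrite /b fineK// ge0_fin_numE ?Lnorm_ge0// ltey.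
have b0 : 0 <= b by rewrite fine_ge0 ?Lnorm_ge0.
rewrite intE bE poweR_EFin lee_fin; apply: ge0_ler_powR; rewrite ?nnegrE ?(ltW p0)//.
by rewrite -lee_fin -bE.
Qed.

End Limits.

(** * Deviation of sums and averages from their mean *)

Section CenteredSum.
Variables (R : realType) (d : measure_display) (T : measurableType d).
Variables (P : probability T R) (e e' : int -> {RV P >-> R}).
Hypothesis iid : iid_uniform_copies e e'.
Variables (p : R) (h : nat -> product_space R nat -> R).
Hypothesis p2 : 2 <= p.
Hypothesis mh : forall t, measurable_fun setT (h t).

Local Notation xi := (fun (w : T) (i : int + int) => innovation e e' i w).

Definition fresh_sum (n : nat) (w : T) : R :=
  \sum_(t < n) h t (fun k => xi w (fresh t k)).

Lemma measurable_fresh_sum n : measurable_fun setT (fresh_sum n).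
Proof.
apply: measurable_sum => t.
exact: (measurableT_comp (mh t) (measurable_innovations _ _ _)).
Qed.

(** Once [N] exceeds [k], the k-th argument is fresh, so
    [reindexed_cvg_probability] applies to each of the [n] terms. *)
Lemma replaced_sum_cvg n (eta : R) : 0 < eta -> exists N0, forall N, (N0 <= N)%N ->
  (P [set w | (eta < `|replaced_sum e e' h n N w - fresh_sum n w|)%R] <= eta%:E)%E.
Proof.
elim: n eta => [|n IH] eta eta0.
  exists 0%N => N _; rewrite (_ : [set _ | _] = set0) ?measure0 ?lee_fin ?ltW//.
  apply/seteqP; split => // w /=.
  by rewrite /replaced_sum /fresh_sum !big_ord0 subrr normr0 ltNge (ltW eta0).
have e2 : 0 < eta / 2 by lra.
have [N1 h1] := IH _ e2.
have [N2 h2] : exists N2, forall N, (N2 <= N)%N ->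
  (P [set w | (eta / 2 < `|h n (fun k => xi w (mixed n N k)) - h n (fun k =>
    xi w (fresh n k))|)%R] <= (eta / 2)%:E)%E.
  apply: (@reindexed_cvg_probability _ _ _ P (fun N w k =>
    xi w (mixed n N k)) (fun w k => xi w (fresh n k))) => //.
  - move=> N; apply: innovation_reindex => //; first exact: mixed_inj.
    by move=> k k' /fresh_inj[].
  - by move=> N k w kN; rewrite /mixed kN.
exists (maxn N1 N2) => N; rewrite geq_max => /andP[hN1 hN2].
have mg t sg : measurable_fun setT (fun w => h t (fun k => xi w (sg k))).
  exact: (measurableT_comp (mh t) (measurable_innovations e e' sg)).
have mA : measurable [set w | (eta / 2 < `|replaced_sum e e' h n N w - fresh_sum n w|)%R].
  apply: measurable_superlevel; apply: measurableT_comp => //; apply: measurable_funB.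
    exact: measurable_replaced_sum.
  exact: measurable_fresh_sum.
have mB : measurable [set w | (eta / 2 < `|h n (fun k =>
  xi w (mixed n N k)) - h n (fun k => xi w (fresh n k))|)%R].
  by apply: measurable_superlevel; apply: measurableT_comp => //; apply: measurable_funB.
rewrite (splitr eta) EFinD.
apply: (le_trans _ (leeD (h1 _ hN1) (h2 _ hN2))).
apply: (le_trans _ (measureU2 P mA mB)).
apply: le_measure; rewrite ?inE.
- apply: measurable_superlevel; apply: measurableT_comp => //; apply: measurable_funB.
    exact: measurable_replaced_sum.
  exact: measurable_fresh_sum.
- exact: measurableU.
- move=> w /=; rewrite /replaced_sum /fresh_sum !big_ord_recr/=.
  set a1 := \sum_(t < n) _; set b1 := \sum_(t < n) _; set a2 := h n _; set b2 := h n _ => hw.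
  have hab : `|a1 + a2 - (b1 + b2)| <= `|a1 - b1| + `|a2 - b2|.
    by apply: le_trans (ler_normD _ _); rewrite opprD addrACA.
  have [h3|h3] := ltP (eta / 2) `|a1 - b1|; [by left|right => /=].
  lra.
Qed.

Variables (A : R) (delta : nat -> R).
Hypothesis A0 : 0 <= A.
Hypothesis hA : forall t, (norm_Lp P p (fun w => h t (past e 0 w)) <= A%:E)%E.
Hypothesis delta0 : forall l, 0 <= delta l.
Hypothesis deltaA : 2 * A <= delta 0%N.
Hypothesis hdelta : forall t l, (1 <= l)%N ->
  (norm_Lp P p (fun w => h t (past e t.+1%:Z w) -
     h t (coupled_past e e' t.+1%:Z (t.+1%:Z - l%:Z) w))%R <= (delta l)%:E)%E.

(** Only the marginal laws of the terms agree, hence linearity. *)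
Lemma expectation_fresh_sum n :
  ('E_P[fresh_sum n] = 'E_P[replaced_sum e e' h n 0])%E.
Proof.
have inj0 t : injective (fresh t) by move=> k k' /fresh_inj[].
have ih t sg : injective sg -> P.-integrable setT (EFin \o (fun w => h t (fun k =>
  xi w (sg k)))).
  move=> isg; apply: (@norm_Lp_integrable _ _ _ _ _ p A).
  - by apply: le_trans p2; rewrite ler1n.
  - exact: (measurableT_comp (mh t) (measurable_innovations e e' sg)).
  - exact: (norm_Lp_reindexed_past iid mh hA).
have E (sg : nat -> nat -> int + int) : (forall t, injective (sg t)) ->
    ('E_P[(fun w => \sum_(t < n) h t (fun k => xi w (sg t k)))%R] =
     \sum_(t < n) \int[P]_w (h t (fun k => xi w (sg t k)))%:E)%E.
  move=> isg; rewrite unlock.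
  have iG (t : 'I_n) : P.-integrable setT (fun w => (h t (fun k => xi w (sg t k)))%:E).
    by apply: (ih t (sg t)); exact: isg.
  rewrite -(integral_sum measurableT iG).
  by apply: eq_integral => w _; rewrite sumEFin.
apply: (etrans (E fresh inj0)); apply/esym.
apply: (etrans (E (fun t => mixed t 0) _)) => [t|]; first exact: mixed_inj.
apply/esym.
apply: eq_bigr => t _.
rewrite integralE [RHS]integralE.
have key (G : product_space R nat -> R) : measurable_fun setT G -> (forall x, 0 <= G x) ->
   (\int[P]_w (G (fun k => xi w (fresh t k)))%:E = \int[P]_w (G (fun k =>
     xi w (mixed t 0 k)))%:E)%E.
  move=> mG G0; apply: same_law_integral => //.
  by apply: innovation_reindex => //; exact: mixed_inj.
have pos (G : product_space R nat -> R) : measurable_fun setT G ->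
   (\int[P]_w maxe (G (fun k => xi w (fresh t k)))%:E 0 = \int[P]_w maxe (G (fun k =>
     xi w (mixed t 0 k)))%:E 0)%E.
  move=> mG; transitivity (\int[P]_w (Num.max (G (fun k => xi w (fresh t k))) 0)%:E)%E.
    by apply: eq_integral => w _; rewrite EFin_max.
  rewrite (key (fun x => Num.max (G x) 0)).
  - by apply: eq_integral => w _; rewrite EFin_max.
  - exact: measurable_maxr.
  - by move=> x; rewrite le_max lexx orbT.
congr (_ - _)%E.
  under eq_integral do rewrite funeposE.
  by under [in RHS]eq_integral do rewrite funeposE; exact: (pos (h t) (mh t)).
under eq_integral do rewrite funenegE.
under [in RHS]eq_integral do rewrite funenegE.
exact: (pos (fun x => - h t x) (measurable_funN (mh t))).
Qed.

(** In the limit of all innovations replaced, the difference of the two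
    sums keeps its bound.  The original sum reads the first sequence and the
    limit reads the second, so the moment is a double integral; Jensen's
    inequality in the inner one replaces the limit by its mean. *)
Lemma norm_Lp_centered_sum (C D : R) (n : nat) : smoothness_constant p C -> 0 < D ->
  (0 < n)%N ->
  (forall N, \sum_(l < N) delta l <= D) ->
  (norm_Lp P p (fun w => replaced_sum e e' h n 0 w - fine 'E_P[replaced_sum e e' h n 0])%R
     <= (2 * (Num.sqrt (n%:R * C) * D))%:E)%E.
Proof.
move=> pC D0 n0 hD; have C0 := pC.1.
have p1 : 1 <= p by apply: le_trans p2; rewrite ler1n.
have p0 : 0 < p by exact: lt_le_trans p1.
have sC : 0 < Num.sqrt (n%:R * C) by rewrite sqrtr_gt0 mulr_gt0// ltr0n.
have mS := measurable_replaced_sum e e' mh n.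
have mF := measurable_fresh_sum n.
have h1 : (norm_Lp P p (fun w => replaced_sum e e' h n 0 w - fresh_sum n w)%R
     <= (2 * (Num.sqrt (n%:R * C) * D))%:E)%E.
  apply: (@norm_Lp_limit _ _ _ _ (fun N w =>
    replaced_sum e e' h n 0 w - replaced_sum e e' h n N w)) => //.
  - by rewrite mulr_gt0.
  - exact: measurable_funB.
  - by move=> N; apply: measurable_funB.
  - by move=> N; apply: (norm_Lp_replaced_sum iid p2 mh A0 hA delta0 deltaA hdelta n pC).
  - move=> eta /(replaced_sum_cvg n)[N0 hN]; exists N0.
    rewrite (_ : [set _ | _] = [set w | (eta < `|replaced_sum e e' h n N0 w - fresh_sum n
      w|)%R]); first exact: hN.
    have cancel (a b c : R) : `|a - b - (a - c)| = `|b - c|.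
      by rewrite distrC; congr `|_|; ring.
    by apply/seteqP; split => w /=; rewrite cancel.
apply/norm_LpP => //; first by rewrite !mulr_ge0// ltW.
move/norm_LpP : h1 => /(_ p0) h1.
apply: le_trans (h1 _); last by rewrite !mulr_ge0// ltW.
pose F (x : product_space R (int + int)%type) := `|\sum_(t < n) h t (fun k => x (mixed t 0 k)) -
    \sum_(t < n) h t (fun k => x (fresh t k))| `^ p.
have mFF : measurable_fun setT F.
  apply: (@measurableT_comp _ _ _ _ _ _ (@powR R ^~ p)) => //.
  apply: measurableT_comp => //; apply: measurable_funB; apply: measurable_sum => t;
    exact: measurable_reindexed_past.
have -> : (\int[P]_w (`|replaced_sum e e' h n 0 w - fresh_sum n w| `^ p)%R%:E =
  \int[(P \x P)%E]_w (`|replaced_sum e e' h n 0 w.1 - fresh_sum n w.2| `^ p)%R%:E)%E.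
  apply: (@same_law_integral _ _ _ _ _ _ _ _ _ _ F _ _ (innovation_product iid)) => //.
  - move=> [t|t].
      by apply: (measurableT_comp (measurable_funPT (e t))).
    by apply: (measurableT_comp (measurable_funPT (e' t))).
  - by move=> x; exact: powR_ge0.
pose H (w : T * T) := (`|replaced_sum e e' h n 0 w.1 - fresh_sum n w.2| `^ p)%:E.
have mH : measurable_fun setT H.
  apply/measurable_EFinP; apply: measurable_powR_norm.
  apply: measurable_funB.
    exact: (measurableT_comp (mS 0%N) measurable_fst).
  exact: (measurableT_comp mF measurable_snd).
have H0 w : (0 <= H w)%E by rewrite lee_fin powR_ge0.
rewrite (fubini_tonelli1 _ mH H0).
have iF : P.-integrable setT (EFin \o fresh_sum n).
  apply: (@norm_Lp_integrable _ _ _ _ _ p (\sum_(t < n) A)) => //.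
  apply: norm_Lp_sum => // t.
    exact: (measurableT_comp (mh t) (measurable_innovations e e' _)).
  apply: (norm_Lp_reindexed_past iid mh hA).
  by move=> k k' /fresh_inj[].
apply: ge0_le_integral => //.
- apply/measurable_EFinP/measurable_powR_norm; exact: measurable_funB.
- exact: measurable_fun_fubini_tonelli_F.
- move=> w _; rewrite -expectation_fresh_sum /fubini_F/=.
  exact: jensen_norm.
Qed.

End CenteredSum.

(** x^-2 <= 2/x - 2/(x+1) for x >= 1, and the right side telescopes. *)
Lemma sum_powR_le2 (R : realType) (beta : R) (N : nat) : 2 <= beta ->
  \sum_(l < N) l.+1%:R `^ (- beta) <= 2 :> R.
Proof.
move=> b2.
suff h : \sum_(l < N) l.+1%:R `^ (- beta) <= 2 - 2 / N.+1%:R :> R.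
  by apply: (le_trans h); rewrite gerBl divr_ge0// ler0n.
elim: N => [|N IH]; first by rewrite big_ord0 divr1 subrr.
rewrite big_ord_recr/=; apply: (le_trans (lerD IH (lexx _))).
set x : R := N.+1%:R.
have x1 : 1 <= x by rewrite /x ler1n.
have -> : N.+2%:R = x + 1 :> R by rewrite /x natr1.
apply: (@le_trans _ _ (2 - 2 / x + x `^ (- 2))).
  by rewrite lerD2l; apply: ler_powR => //; rewrite lerN2.
have x0 : 0 < x by lra.
rewrite powRN powR_mulrn ?(ltW x0)//.
have -> : 2 - 2 / x + (x ^+ 2)^-1 = 2 - 2 / (x + 1) - (x - 1) / (x ^+ 2 * (x + 1)).
  by field; rewrite !gt_eqF//; lra.
by rewrite gerBl divr_ge0 ?mulr_ge0 ?sqr_ge0//; lra.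
Qed.

(** Bounds for the increments at each lag; at lag 0 the bound is the one
    given by the triangle inequality. *)
Definition dependence_rate (R : realType) (A c beta : R) (l : nat) : R :=
  if l is l'.+1 then c * l'.+1%:R `^ (- beta) else 2 * A.

Section MeanDeviation.
Variables (R : realType) (d : measure_display) (T : measurableType d).
Variables (P : probability T R) (e e' : int -> {RV P >-> R}).
Hypothesis iid : iid_uniform_copies e e'.

Lemma norm_Lp_mean_deviation (p C A c beta : R) (g : nat -> product_space R nat ->
  R) (n : nat) :
  2 <= p -> smoothness_constant p C ->
  2 <= beta -> 0 < A -> 0 < c ->
  (forall t, (1 <= t)%N -> measurable_fun setT (g t)) ->
  (forall t, (1 <= t)%N -> (norm_Lp P p (fun w => g t (past e 0 w)) <= A%:E)%E) ->
  (forall t l, (1 <= t)%N -> (1 <= l)%N ->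
    (norm_Lp P p (fun w => g t (past e t%:Z w) -
       g t (coupled_past e e' t%:Z (t%:Z - l%:Z) w))%R <= (c * l%:R `^ (- beta))%:E)%E) ->
  (0 < n)%N ->
  let avg := fun w => n%:R^-1 * \sum_(1 <= t < n.+1) g t (past e t%:Z w) in
  [/\ measurable_fun setT avg,
      (norm_Lp P p avg <= A%:E)%E &
      (norm_Lp P p (fun w => avg w - fine 'E_P[avg])%R
        <= (4 * Num.sqrt C * (A + c) / Num.sqrt n%:R)%:E)%E].
Proof.
move=> p2 pC b2 A0 c0 mg gA gd n0 avg.
have C0 := pC.1; have p1 : 1 <= p by lra.
have p0 : 0 < p by lra.
have nR : 0 < n%:R :> R by rewrite ltr0n.
pose h t := g t.+1.
have mh t : measurable_fun setT (h t) by exact: mg.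
have hA t : (norm_Lp P p (fun w => h t (past e 0 w)) <= A%:E)%E by exact: gA.
pose delta := dependence_rate A c beta.
have delta0 l : 0 <= delta l.
  by case: l => [|l] /=; rewrite mulr_ge0 ?powR_ge0// ltW.
have hd t l : (1 <= l)%N -> (norm_Lp P p (fun w => h t (past e t.+1%:Z w) -
     h t (coupled_past e e' t.+1%:Z (t.+1%:Z - l%:Z) w))%R <= (delta l)%:E)%E.
  by case: l => // l _; exact: gd.
have sumd N : \sum_(l < N) delta l <= 2 * (A + c).
  case: N => [|N]; first by rewrite big_ord0 mulr_ge0// addr_ge0// ltW.
  rewrite big_ord_recl/= mulrDr lerD2l/= -mulr_sumr mulrC ler_wpM2r ?(ltW c0)//.
  exact: sum_powR_le2.
have D0 : 0 < 2 * (A + c) by lra.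
have dA : 2 * A <= delta 0%N by [].
have hS := norm_Lp_centered_sum iid p2 mh (ltW A0) hA delta0 dA hd pC D0 n0 sumd.
pose S := replaced_sum e e' h n 0.
have avgE w : avg w = n%:R^-1 * S w.
  rewrite /avg big_add1 /= big_mkord; congr (_ * _).
have mS : measurable_fun setT S by exact: measurable_replaced_sum.
have -> : avg = fun w => n%:R^-1 * S w by apply/funext.
have nS : (norm_Lp P p S <= (n%:R * A)%:E)%E.
  have -> : n%:R * A = \sum_(t < n) A by rewrite sumr_const card_ord mulr_natl.
  apply: norm_Lp_sum => // t.
    exact: (measurableT_comp (mh t) (measurable_innovations e e' _)).
  apply: (norm_Lp_reindexed_past iid mh hA); exact: mixed_inj.
split.
- exact: measurable_funM.
- apply: (@le_trans _ _ (`|n%:R^-1| * (n%:R * A))%:E).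
    by apply: norm_LpZ => //; rewrite mulr_ge0// ltW.
  by rewrite ger0_norm ?invr_ge0 ?ler0n// mulKf ?gt_eqF.
have iS := norm_Lp_integrable p1 mS nS.
have -> : fine ('E_P[fun w => (n%:R^-1 * S w)%R])%E = n%:R^-1 * fine ('E_P[S])%E.
  rewrite unlock; under eq_integral do rewrite EFinM.
  by rewrite integralZl// fineM// integrable_fin_num.
under [X in norm_Lp _ _ X]eq_fun do rewrite -mulrBr.
apply: (@le_trans _ _ (`|n%:R^-1| * (2 * (Num.sqrt (n%:R * C) * (2 * (A + c)))))%:E).
  apply: norm_LpZ => //; last by apply: measurable_funB.
  by rewrite mulr_ge0// mulr_ge0 ?sqrtr_ge0// ltW.
rewrite lee_fin ger0_norm ?invr_ge0 ?ler0n// sqrtrM ?ler0n//.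
have s0 : 0 < Num.sqrt n%:R :> R by rewrite sqrtr_gt0.
rewrite -[X in X^-1 * _](sqr_sqrtr (ltW nR)).
rewrite le_eqVlt; apply/orP; left; apply/eqP.
by field; rewrite gt_eqF.
Qed.

End MeanDeviation.

(** * Entries of the sample covariance *)

Section SampleEntries.
Variables (R : realType) (T : Type) (n : nat) (Y : nat -> T -> 'cV[R]_n).

Lemma sample_mean_entry m w i :
  sample_mean Y m w i 0 = m%:R^-1 * \sum_(1 <= t < m.+1) Y t w i 0.
Proof. by rewrite mxE summxE. Qed.

Lemma sample_moment_entry m w i j :
  sample_moment Y m w i j = m%:R^-1 * \sum_(1 <= t < m.+1) Y t w i 0 * Y t w j 0.
Proof.
rewrite mxE summxE; congr (_ * _); apply: eq_bigr => t _.
by rewrite mxE big_ord1 mxE.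
Qed.

Lemma sample_cov_entry m w i j : (0 < m)%N ->
  sample_cov Y m w i j =
  sample_moment Y m w i j - sample_mean Y m w i 0 * sample_mean Y m w j 0.
Proof.
move=> m0; have mR : m%:R != 0 :> R by rewrite pnatr_eq0 -lt0n.
rewrite sample_moment_entry !sample_mean_entry mxE summxE.
set si := \sum_(1 <= t < m.+1) Y t w i 0; set sj := \sum_(1 <= t < m.+1) Y t w j 0.
have -> : \sum_(1 <= t < m.+1) ((Y t w - sample_mean Y m w) *m (Y t w - sample_mean Y m
  w)^T) i j
  = \sum_(1 <= t < m.+1) (Y t w i 0 * Y t w j 0 - m%:R^-1 * sj * Y t w i 0
    - m%:R^-1 * si * Y t w j 0 + m%:R^-1 * si * (m%:R^-1 * sj)).
  apply: eq_bigr => t _; rewrite mxE big_ord1 [trmx _ _ _]mxE.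
  have subE (x y : 'cV[R]_n) k : (x - y) k 0 = x k 0 - y k 0 by rewrite !mxE.
  rewrite !subE !sample_mean_entry -/si -/sj.
  by ring.
rewrite big_split/= !sumrB -!mulr_sumr -/si -/sj.
rewrite sumr_const_nat subSS subn0 -mulr_natl.
by field.
Qed.

End SampleEntries.

Section Entries.
Variables (R : realType) (d : measure_display) (T : measurableType d).
Variables (P : probability T R) (e e' : int -> {RV P >-> R}).
Hypothesis iid : iid_uniform_copies e e'.
Variables (n : nat) (G : nat -> (nat -> R) -> 'cV[R]_n) (beta q K C1 : R).
Hypothesis mG : forall t, (1 <= t)%N -> measurable_seq_map (G t).
Hypothesis dep : dependence_condition e e' G beta q K C1.
Hypothesis q4 : 4 < q.
Hypothesis beta2 : 2 < beta.

Let Y := observation e G.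
Let A : R := 2 * (`|K| + 1).
Let c : R := `|C1| + 1.

Let A0 : 0 < A. Proof. by rewrite mulr_gt0// ltr_pwDr. Qed.
Let c0 : 0 < c. Proof. by rewrite ltr_pwDr. Qed.
Let q1 : 1 <= q. Proof. by apply: le_trans (ltW q4); rewrite ler1n. Qed.
Let q0 : 0 < q. Proof. exact: lt_le_trans q1. Qed.

Lemma measurable_coordinate t i : (1 <= t)%N ->
  measurable_fun setT (fun x : product_space R nat => G t x i 0).
Proof. by move=> t1; exact: mG. Qed.

Lemma norm_Lp_coordinate t i : (1 <= t)%N ->
  (norm_Lp P q (fun w => G t (past e 0 w) i 0)%R <= A%:E)%E.
Proof.
move=> t1; have [h1 h2 _] := dep i t1.
set mu := expect_mx _ _ _ _ in h1 h2.
have mX : measurable_fun setT (fun w => G t (past e 0 w) i 0).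
  apply: (measurableT_comp (measurable_coordinate i t1)).
  exact: (measurable_innovations e e' (fun k => inl (0 - k%:Z))).
have -> : (fun w => G t (past e 0 w) i 0) = (fun w => (G t (past e 0 w) i 0 - mu) + mu).
  by apply/funext => w; rewrite subrK.
apply: (@le_trans _ _ (K + K)%:E).
  apply: norm_LpD => //; first exact: measurable_funB.
  by rewrite norm_Lp_cst// lee_fin.
rewrite lee_fin /A; have := ler_norm K; lra.
Qed.

Lemma norm_Lp_coordinateB t l i : (1 <= t)%N -> (1 <= l)%N ->
  (norm_Lp P q (fun w => G t (past e t%:Z w) i 0 -
     G t (coupled_past e e' t%:Z (t%:Z - l%:Z) w) i 0)%R <= (c * l%:R `^ (- beta))%:E)%E.
Proof.
move=> t1 l1; have [_ _ /(_ _ l1) h] := dep i t1.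
apply: (le_trans h); rewrite lee_fin ler_wpM2r ?powR_ge0// /c.
have := ler_norm C1; lra.
Qed.

Let coupled_index (t l k : nat) : int + int :=
  if k == l then inr (t%:Z - l%:Z) else inl (t%:Z - k%:Z).

Let coupled_pastE t l w : coupled_past e e' t%:Z (t%:Z - l%:Z) w =
  fun k => innovation e e' (coupled_index t l k) w.
Proof.
apply/funext => k; rewrite /coupled_past /coupled_index.
have -> : (t%:Z - k%:Z == t%:Z - l%:Z) = (k == l) by lia.
by case: ifP.
Qed.

Let coupled_index_inj t l : injective (coupled_index t l).
Proof.
move=> k k'; rewrite /coupled_index; case: eqP => [->|kl]; case: eqP => [->|kl'] //.
by move=> /lag_inj.
Qed.

(** Stationarity of the innovations. *)
Lemma norm_Lp_coordinate_reindex t i (sg : nat -> int + int) : (1 <= t)%N -> injective sg ->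
  (norm_Lp P q (fun w => G t (fun k => innovation e e' (sg k) w) i 0)%R <= A%:E)%E.
Proof.
move=> t1 isg.
apply: (norm_Lp_reindexed_past iid (h := fun _ x => G t x i 0)) => // _.
  exact: measurable_coordinate.
exact: norm_Lp_coordinate.
Qed.

Lemma norm_Lp_product t i j : (1 <= t)%N ->
  (norm_Lp P (q / 2) (fun w => G t (past e 0 w) i 0 * G t (past e 0 w) j 0)%R <= (A * A)%:E)%E.
Proof.
move=> t1; have mX k : measurable_fun setT (fun w => G t (past e 0 w) k 0).
  apply: (measurableT_comp (measurable_coordinate k t1)).
  exact: (measurable_innovations e e' (fun k => inl (0 - k%:Z))).
by apply: norm_LpM; rewrite ?divr_gt0 ?(ltW A0)// mulrC divfK//; exact: norm_Lp_coordinate.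
Qed.

(** Replace one factor at a time and apply Cauchy-Schwarz. *)
Lemma norm_Lp_productB t l i j : (1 <= t)%N -> (1 <= l)%N ->
  (norm_Lp P (q / 2) (fun w => G t (past e t%:Z w) i 0 * G t (past e t%:Z w) j 0 -
     G t (coupled_past e e' t%:Z (t%:Z - l%:Z) w) i 0 *
     G t (coupled_past e e' t%:Z (t%:Z - l%:Z) w) j 0)%R
     <= (2 * A * c * l%:R `^ (- beta))%:E)%E.
Proof.
move=> t1 l1.
have mX k : measurable_fun setT (fun w => G t (past e t%:Z w) k 0).
  apply: (measurableT_comp (measurable_coordinate k t1)).
  exact: (measurable_innovations e e' (fun k => inl (t%:Z - k%:Z))).
have mX' k : measurable_fun setT (fun w => G t (coupled_past e e' t%:Z (t%:Z - l%:Z) w) k 0).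
  under eq_fun do rewrite coupled_pastE.
  apply: (measurableT_comp (measurable_coordinate k t1)).
  exact: (measurable_innovations e e' (coupled_index t l)).
have nX k : (norm_Lp P q (fun w => G t (past e t%:Z w) k 0)%R <= A%:E)%E.
  exact: (norm_Lp_coordinate_reindex k t1 (@lag_inj t%:Z)).
have nX' k : (norm_Lp P q (fun w =>
  G t (coupled_past e e' t%:Z (t%:Z - l%:Z) w) k 0)%R <= A%:E)%E.
  under [X in norm_Lp _ _ X]eq_fun do rewrite coupled_pastE.
  exact: (norm_Lp_coordinate_reindex k t1 (@coupled_index_inj t l)).
have nD k := norm_Lp_coordinateB k t1 l1.
set x := fun w => G t (past e t%:Z w) i 0 in mX nX nD *.
have q20 : 0 < q / 2 by rewrite divr_gt0.
have cl0 : 0 <= c * l%:R `^ (- beta) by rewrite mulr_ge0 ?powR_ge0// ltW.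
have q2E : 2 * (q / 2) = q by rewrite mulrC divfK.
have -> : 2 * A * c * l%:R `^ (- beta) =
   (c * l%:R `^ (- beta)) * A + A * (c * l%:R `^ (- beta)) by ring.
under [X in norm_Lp _ _ X]eq_fun => w.
  rewrite (_ : _ - _ = (G t (past e t%:Z w) i 0 - G t (coupled_past e e' t%:Z (t%:Z -
    l%:Z) w) i 0) * G t (past e t%:Z w) j 0 +
    G t (coupled_past e e' t%:Z (t%:Z - l%:Z) w) i 0 * (G t (past e t%:Z w) j 0 - G t
      (coupled_past e e' t%:Z (t%:Z - l%:Z) w) j 0)); last by ring.
  over.
apply: norm_LpD.
- by rewrite ler_pdivlMr// mul1r (le_trans _ (ltW q4))// ler_nat.
- by apply: measurable_funM => //; exact: measurable_funB.
- by apply: measurable_funM => //; exact: measurable_funB.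
- by apply: norm_LpM; rewrite ?q2E ?(ltW A0)//; exact: measurable_funB.
- by apply: norm_LpM; rewrite ?q2E ?(ltW A0)//; exact: measurable_funB.
Qed.

Variables (Cq Cp : R).
Hypothesis hCq : smoothness_constant q Cq.
Hypothesis hCp : smoothness_constant (q / 2) Cp.

Let Cmean : R := 4 * Num.sqrt Cq * (A + c).
Let Cmoment : R := 4 * Num.sqrt Cp * (A * A + 2 * A * c).

Definition cov_error (m : nat) (i j : 'I_n) (w : T) : R :=
  sample_cov Y m w i j - cov_bar P Y m i j.

(** With u the sample mean and b its expectation, E_ij is the centred sample
    moment minus the sum of (u_i - b_i) u_j and b_i (u_j - b_j).  The factors of the
    products are bounded in L^q. *)
Lemma norm_Lp_cov_error m i j : (0 < m)%N ->
  measurable_fun setT (cov_error m i j) /\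
  (norm_Lp P (q / 2) (cov_error m i j) <=
    ((Cmoment + 2 * A * Cmean + Cmean * Cmean) / Num.sqrt m%:R)%:E)%E.
Proof.
move=> m0.
have mR : 1 <= Num.sqrt m%:R :> R.
  by rewrite -[leLHS]sqrtr1 ler_sqrt ?ler0n// ler1n.
have q2 : 2 <= q by apply: le_trans (ltW q4); rewrite ler_nat.
have q22 : 2 <= q / 2 by rewrite ler_pdivlMr// -natrM (ltW q4).
have q21 : 1 <= q / 2 by apply: le_trans q22; rewrite ler1n.
have q20 : 0 < q / 2 by rewrite divr_gt0.
have q2E : 2 * (q / 2) = q by rewrite mulrC divfK.
have hm k := norm_Lp_mean_deviation iid q2 hCq (ltW beta2) A0 c0
  (fun t => @measurable_coordinate t k) (fun t => @norm_Lp_coordinate t k)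
  (fun t l => @norm_Lp_coordinateB t l k) m0.
have AA : 0 < A * A by rewrite mulr_gt0.
have Ac : 0 < 2 * A * c by rewrite !mulr_gt0.
have mprod t : (1 <= t)%N -> measurable_fun setT (fun x : product_space R nat =>
  G t x i 0 * G t x j 0).
  by move=> t1; apply: measurable_funM; exact: measurable_coordinate.
have := norm_Lp_mean_deviation iid q22 hCp (ltW beta2) AA Ac
  mprod (fun t => @norm_Lp_product t i j)
  (fun t l => @norm_Lp_productB t l i j) m0.
set M := fun w => _ * _ => -[mM _ nM].
have ME : (fun w => sample_moment Y m w i j) = M.
  by apply/funext => w; rewrite sample_moment_entry.
pose u k w := sample_mean Y m w k 0.
have uE k : u k = (fun w => m%:R^-1 * \sum_(1 <= t < m.+1) G t (past e t%:Z w) k 0).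
  by apply/funext => w; rewrite /u sample_mean_entry.
have [mu nu du] : [/\ forall k, measurable_fun setT (u k),
   forall k, (norm_Lp P q (u k) <= A%:E)%E &
   forall k, (norm_Lp P q (fun w => u k w - mean_bar P Y m k 0)%R <=
     (Cmean / Num.sqrt m%:R)%:E)%E].
  split=> k; have [h1 h2 h3] := hm k; rewrite ?uE//.
  rewrite mxE -/(u k) uE.
  exact: h3.
pose b k := mean_bar P Y m k 0.
have CM0 : 0 <= Cmean by rewrite !mulr_ge0 ?sqrtr_ge0// addr_ge0// ltW.
have Cs : Cmean / Num.sqrt m%:R <= Cmean by rewrite ler_pdivrMr ?ler_peMr// (lt_le_trans ltr01).
have Cs0 : 0 <= Cmean / Num.sqrt m%:R by rewrite divr_ge0// sqrtr_ge0.
have mub k : measurable_fun setT (fun w => u k w - b k) by exact: measurable_funB.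
have bb k : `|b k| <= A + Cmean.
  rewrite -lee_fin -(norm_Lp_cst P (b k) q0).
  rewrite (_ : (fun=> b k) = fun w => u k w - (u k w - b k)); last first.
    by apply/funext => w; rewrite subKr.
  apply: norm_LpB => //.
  by apply: (le_trans (du k)); rewrite lee_fin.
have EE : cov_error m i j = fun w =>
   (M w - fine ('E_P[M])%E) - ((u i w - b i) * u j w + b i * (u j w - b j)).
  apply/funext => w; rewrite /cov_error sample_cov_entry// -/(u i w) -/(u j w).
  rewrite -[sample_moment Y m w i j]/((fun w => sample_moment Y m w i j) w) ME.
  have -> : cov_bar P Y m i j = fine ('E_P[M])%E - b i * b j.
    rewrite /cov_bar -ME /b; move: (mean_bar P Y m) => v.
    by rewrite !mxE big_ord1 !mxE.
  by ring.
have m1 : measurable_fun setT (fun w => M w - fine ('E_P[M])%E) by exact: measurable_funB.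
have m2 : measurable_fun setT (fun w => (u i w - b i) * u j w) by exact: measurable_funM.
have m3 : measurable_fun setT (fun w => b i * (u j w - b j)) by exact: measurable_funM.
rewrite EE; split; first by apply: measurable_funB => //; exact: measurable_funD.
apply: (@le_trans _ _ (Cmoment / Num.sqrt m%:R +
    (Cmean / Num.sqrt m%:R * A + (A + Cmean) * (Cmean / Num.sqrt m%:R)))%:E); last first.
  rewrite lee_fin le_eqVlt; apply/orP; left; apply/eqP.
  by field; rewrite gt_eqF// (lt_le_trans ltr01).
apply: norm_LpB => //; first exact: measurable_funD.
apply: norm_LpD => //.
  by apply: norm_LpM; rewrite ?q2E ?(ltW A0).
apply: norm_LpM; rewrite ?q2E ?addr_ge0 ?(ltW A0)//.
by rewrite norm_Lp_cst// lee_fin.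
Qed.

End Entries.

(** * Stochastic orders and the convergence rate *)

(** The bound of [threshold_opbound] at t = Cth * rho is
    kappa * rho^(1-r): the exceptional entries contribute a multiple of
    [rho], and rho <= rho^(1-r). *)
Lemma precision_error (R : realType) (n : nat) (Sg Sh : 'M[R]_n) (S : R -> R -> R)
    (r Cth rho p s0 e B : R) :
  soft_thresholding S -> 0 <= r -> r < 1 -> 0 < Cth -> 0 < rho -> rho <= 1 ->
  2 <= p -> Sg^T = Sg -> 0 < e -> e <= lambda_min Sg -> 0 <= s0 ->
  (forall i, \sum_j abspow r (Sg i j) <= s0) -> 0 <= B ->
  \sum_i \sum_j `|Sh i j - Sg i j| `^ p <= B * rho `^ p ->
  let kappa := 3 * s0 * Cth `^ (1 - r) + 3 * Num.sqrt (B * (Cth / 2) `^ (2 - p)) in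
  kappa * rho `^ (1 - r) <= e / 2 ->
  `|opnorm (invmx (map_mx (S (Cth * rho)) Sh) - invmx Sg)|
     <= 2 / e ^+ 2 * kappa * rho `^ (1 - r).
Proof.
move=> hS r0 r1 C0 rho0 rho1 p2 sym e0 eS s00 row B0 hB kappa hk.
have r1' : 0 < 1 - r by lra.
have t0 : 0 < Cth * rho by rewrite mulr_gt0.
have k0 : 0 <= kappa by rewrite addr_ge0// mulr_ge0 ?sqrtr_ge0// ?powR_ge0// mulr_ge0.
have h1 := threshold_opbound hS r0 r1 t0 p2 sym row s00 hB.
have h2 : opbound (map_mx (S (Cth * rho)) Sh - Sg) (kappa * rho `^ (1 - r)).
  move=> x; apply: (le_trans (h1 x)); rewrite ler_wpM2r ?norm2_ge0//.
  rewrite powRM ?(ltW C0) ?(ltW rho0)// /kappa [leRHS]mulrDl [3 * s0 * (_ * _)]mulrA lerD2l.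
  rewrite -(mulrA 3) ler_wpM2l//.
  have -> : B * rho `^ p * (Cth * rho / 2) `^ (2 - p) = (B * (Cth / 2) `^ (2 - p)) * rho ^+ 2.
    have -> : Cth * rho / 2 = (Cth / 2) * rho by ring.
    rewrite powRM ?divr_ge0 ?(ltW C0) ?(ltW rho0)//.
    have -> : rho ^+ 2 = rho `^ p * rho `^ (2 - p).
      rewrite -powRD ?(gt_eqF rho0) ?implybT// addrC subrK.
      by rewrite powR_mulrn// ltW.
    by ring.
  rewrite sqrtrM ?mulr_ge0 ?powR_ge0// sqrtr_sqr gtr0_norm// ler_wpM2l ?sqrtr_ge0//.
  rewrite -[leLHS]powRr1 ?(ltW rho0)//.
  by apply: ger_powR; rewrite ?rho0//; lra.
have kr : 0 <= kappa * rho `^ (1 - r) by rewrite mulr_ge0 ?powR_ge0.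
have e2 : 0 <= 2 / e ^+ 2 by rewrite divr_ge0 ?sqr_ge0.
rewrite -mulrA; apply: opnorm_le; first by rewrite mulr_ge0.
by apply: invmx_perturbation => //; exact: lambda_min_norm2.
Qed.

Lemma markov_sum (R : realType) d (T : measurableType d) (P : probability T R)
    (n : nat) (E : 'I_n -> 'I_n -> T -> R) (p s a : R) :
  0 < p -> 0 <= s -> 0 < a -> (forall i j, measurable_fun setT (E i j)) ->
  (forall i j, (norm_Lp P p (E i j) <= s%:E)%E) ->
  measurable [set w | (a < \sum_i \sum_j `|E i j w| `^ p)%R] /\
  (P [set w | (a < \sum_i \sum_j `|E i j w| `^ p)%R] <= (n%:R ^+ 2 * s `^ p / a)%:E)%E.
Proof.
move=> p0 s0 a0 mE hE.
pose X w := \sum_i \sum_j `|E i j w| `^ p.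
have mX : measurable_fun setT X.
  by apply: measurable_sum => i; apply: measurable_sum => j; exact: measurable_powR_norm.
have mA := measurable_superlevel a mX.
have X0 w : 0 <= X w by do 2 (apply: sumr_ge0 => ? _); exact: powR_ge0.
split => //; rewrite -/(X _).
rewrite EFinM lee_pdivlMr//.
apply: (@le_trans _ _ (\int[P]_w (X w)%:E)%E).
  set A := [set w | _] in mA *.
  have -> : P A = (\int[P]_w (\1_A w)%:E)%E by rewrite integral_indic// setIT.
  rewrite muleC -ge0_integralZl//; [|exact/measurable_EFinP|by rewrite lee_fin ltW].
  apply: ge0_le_integral => //.
  - by move=> w _; rewrite mule_ge0// lee_fin// ltW.
  - by apply: measurable_funeM; exact/measurable_EFinP.
  - exact/measurable_EFinP.
  - move=> w _; rewrite -EFinM lee_fin indicE.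
    have [h|h] := boolP (w \in _); last by rewrite mulr0.
    by rewrite mulr1 ltW//; move: h; rewrite inE.
rewrite /X; under eq_integral do rewrite -sumEFin.
rewrite ge0_integral_sum//; last 2 first.
- by move=> i; apply/measurable_EFinP; apply: measurable_sum => j; exact: measurable_powR_norm.
- by move=> i w _; rewrite lee_fin; apply: sumr_ge0 => j _; exact: powR_ge0.
have -> : (n%:R ^+ 2 * s `^ p)%:E = (\sum_(i < n) \sum_(j < n) (s `^ p)%:E)%E.
  under eq_bigr do rewrite sumEFin; rewrite sumEFin.
  by rewrite !sumr_const !card_ord -mulrnA -(mulr_natl (s `^ p)) natrM expr2.
apply: lee_sum => i _; under eq_integral do rewrite -sumEFin.
rewrite ge0_integral_sum//; last first.
  by move=> j; apply/measurable_EFinP; exact: measurable_powR_norm.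
by apply: lee_sum => j _; apply/norm_LpP.
Qed.

(** If d <= eta^(q/4) m^(q/8), then d^(4/q) <= eta sqrt m. *)
Lemma dim_rate_cvg0 (R : realType) (dim : nat -> nat) (q : R) : 0 < q ->
  (fun m : nat => (dim m)%:R : R^o) =o_\oo (fun m : nat => m%:R `^ (q / 8) : R^o) ->
  forall eta : R, 0 < eta -> \forall m \near \oo, dim_rate dim q m <= eta.
Proof.
move=> q0 /eqoP h eta eta0.
have z0 : 0 < eta `^ (q / 4) by rewrite powR_gt0.
have := h _ z0; apply: filterS2 (nbhs_infty_gt 0) => m m0 /= hm.
have mR : 0 < m%:R :> R by rewrite ltr0n.
rewrite /dim_rate ler_pdivrMr ?sqrtr_gt0//.
move: hm; rewrite !ger0_norm ?powR_ge0 ?ler0n// => hm.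
have q4 : 0 <= 4 / q by rewrite divr_ge0// ltW.
have -> : eta * Num.sqrt m%:R = (eta `^ (q / 4) * m%:R `^ (q / 8)) `^ (4 / q).
  rewrite powRM ?powR_ge0// -!powRrM.
  have -> : q / 4 * (4 / q) = 1 by field; rewrite gt_eqF.
  have -> : q / 8 * (4 / q) = 2^-1 by field; rewrite gt_eqF.
  by rewrite powRr1 ?(ltW eta0)// powR12_sqrt// ltW.
by apply: ge0_ler_powR => //; rewrite nnegrE ?ler0n// mulr_ge0 ?powR_ge0.
Qed.

Lemma mu_extU2 (R : realType) d (T : measurableType d) (P : probability T R) (A B : set T) :
  (mu_ext P (A `|` B) <= mu_ext P A + mu_ext P B)%E.
Proof. exact: (outer_measureU2 (mu_ext P)). Qed.

Lemma bigO_prob_lipschitz (R : realType) d (T : measurableType d) (P : probability T R)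
    (X Z W : nat -> T -> R) (a : nat -> R) (L : R) :
  (forall m, 0 <= a m) ->
  (forall m w, `|Z m w| <= L * (`|X m w| + `|W m w|)) ->
  bigO_prob P X a -> bigO_prob P W a -> bigO_prob P Z a.
Proof.
move=> a0 hZ hX hW delta delta0.
have d2 : 0 < delta / 2 by rewrite divr_gt0.
have [B1 [B10 h1]] := hX _ d2; have [B2 [B20 h2]] := hW _ d2.
exists ((`|L| + 1) * (B1 + B2)); split.
  by apply: mulr_gt0; [rewrite ltr_pwDr|rewrite addr_gt0].
apply: filterS2 h1 h2 => m h1 h2.
rewrite (splitr delta) EFinD; apply: le_trans (leeD h1 h2).
apply: le_trans (mu_extU2 _ _ _); apply: le_mu_ext => w /= hw.
have [h|h] := ltP (B1 * a m) `|X m w|; [by left|right => /=].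
rewrite ltNge; apply/negP => h'.
move: hw; rewrite ltNge => /negP; apply.
apply: (le_trans (hZ m w)).
apply: (@le_trans _ _ ((`|L| + 1) * (`|X m w| + `|W m w|))).
  by rewrite ler_wpM2r ?addr_ge0// (le_trans (ler_norm L))// lerDl.
rewrite -mulrA ler_wpM2l ?addr_ge0// mulrDl.
exact: lerD.
Qed.

(** The constant is chosen before the probability space, the dimension and
    the sample size. *)
Lemma norm_Lp_cov_error_uniform (R : realType) (q K C1 beta : R) : 4 < q -> 2 < beta ->
  exists2 c : R, 0 < c &
  forall (disp : measure_display) (T : measurableType disp) (P : probability T R)
    (e e' : int -> {RV P >-> R}) (n : nat) (G : nat -> (nat -> R) -> 'cV[R]_n) (m : nat),
  iid_uniform_copies e e' ->
  (forall t, (1 <= t)%N -> measurable_seq_map (G t)) ->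
  dependence_condition e e' G beta q K C1 -> (0 < m)%N ->
  forall i j, measurable_fun setT (cov_error e G m i j) /\
   (norm_Lp P (q / 2) (cov_error e G m i j) <= (c / Num.sqrt m%:R)%:E)%E.
Proof.
move=> q4 b2.
have [Cq hCq] := @two_point_inequality R q (le_trans (ler_nat _ 2 4) (ltW q4)).
have q22 : 2 <= q / 2 by rewrite ler_pdivlMr// -natrM (ltW q4).
have [Cp hCp] := two_point_inequality q22.
eexists; last first.
  move=> disp T P e e' n G m iid mG dep m0 i j.
  exact: (norm_Lp_cov_error iid mG dep q4 b2 hCq hCp i j m0).
have A0 : 0 < 2 * (`|K| + 1) by rewrite mulr_gt0// ltr_pwDr.
have c0 : 0 < `|C1| + 1 by rewrite ltr_pwDr.
have [Cq0 _] := hCq; have [Cp0 _] := hCp.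
by rewrite !addr_gt0// !mulr_gt0// ?sqrtr_gt0// addr_gt0// !mulr_gt0.
Qed.

Lemma cov_bar_sym (R : realType) (disp : measure_display) (T : measurableType disp)
    (P : probability T R) (n : nat) (Y : nat -> T -> 'cV[R]_n) (m : nat) :
  (cov_bar P Y m)^T = cov_bar P Y m.
Proof.
apply/matrixP => i j; rewrite mxE /cov_bar.
move: (mean_bar P Y m) => v; rewrite !mxE !big_ord1 !mxE mulrC; congr (fine _ - _).
congr (expectation P _); apply/funext => w; rewrite !sample_moment_entry.
by congr (_ * _); apply: eq_bigr => t _; rewrite mulrC.
Qed.

Theorem theorem8 (R : realType) (beta q K C1 L r S0 M eps0 : R)
    (hbeta : 2 < beta) (hq : 4 < q) (hL : 0 < L) (hr0 : 0 <= r) (hr1 : r < 1) :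
  exists C0 : R, 0 < C0 /\
  forall (disp : measure_display) (T : measurableType disp)
    (P : probability T R) (e e' : int -> {RV P >-> R})
    (dim : nat -> nat)
    (G : forall m : nat, nat -> (nat -> R) -> 'cV[R]_(dim m))
    (s0 : nat -> R) (S : R -> R -> R) (Cth : R),
  let Y := fun m : nat => observation e (G m) in
  let Sigma_bar := fun m : nat => cov_bar P (Y m) m in
  let mu_bar := fun m : nat => mean_bar P (Y m) m in
  let mu_hat := fun (m : nat) (w : T) => sample_mean (Y m) m w in
  let Phi_bar := fun m : nat => invmx (Sigma_bar m) in
  let Phi_hat := fun (m : nat) (w : T) =>
    precision_hat S (Cth * dim_rate dim q m) (Y m) m w in
  let rate := fun m : nat => dim_rate dim q m `^ (1 - r) in
  iid_uniform_copies e e' ->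
  (forall m : nat, (0 < dim m)%N) ->
  (forall m t : nat, (0 < m)%N -> (1 <= t)%N -> measurable_seq_map (G m t)) ->
  (forall m : nat, (0 < m)%N -> dependence_condition e e' (G m) beta q K C1) ->
  (forall m : nat, (0 < m)%N -> bounded_variation_condition e (G m) K L) ->
  (forall n : nat, s0 n <= S0) ->
  (forall m : nat, (0 < m)%N ->
     sparse_class r (s0 (dim m)) M eps0 (Sigma_bar m)) ->
  (fun m : nat => (dim m)%:R : R^o) =o_\oo (fun m : nat => m%:R `^ (q / 8) : R^o) ->
  soft_thresholding S ->
  C0 <= Cth ->
  bigO_prob P (fun m w => opnorm (Phi_hat m w - Phi_bar m)) rate /\
  (forall f : forall m : nat, 'M[R]_(dim m) -> 'cV[R]_(dim m) -> 'cV[R]_(dim m),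
     lipschitz_family f ->
     bigO_prob P (fun m w => norm2 (mu_hat m w - mu_bar m)) rate ->
     bigO_prob P (fun m w =>
       norm2 (f m (Phi_hat m w) (mu_hat m w) - f m (Phi_bar m) (mu_bar m))) rate).
Proof.
(* any positive constant works: errors above the threshold are measured in Frobenius norm *)
exists 1; split; first exact: ltr01.
move=> disp T P e e' dim G s0 S Cth Y Sigma_bar mu_bar mu_hat Phi_bar Phi_hat rate.
move=> iid dim0 mG dep _ s0S sparse dimo hS hCth.
have Cth0 : 0 < Cth by exact: lt_le_trans hCth.
have q0 : 0 < q by lra.
have r1 : 0 < 1 - r by lra.
have p2 : 2 <= q / 2 by lra.
have p0 : 0 < q / 2 by lra.
have rate0 m : 0 <= rate m by exact: powR_ge0.
have e0 : 0 < eps0 by have [] := sparse 1%N isT.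
have precision : bigO_prob P (fun m w => opnorm (Phi_hat m w - Phi_bar m)) rate.
  move=> delta delta0.
  have [c c0 herr] := norm_Lp_cov_error_uniform K C1 hq hbeta.
  (* Markov's inequality bounds the bad event by c^(q/2) / B = delta *)
  pose B := c `^ (q / 2) / delta.
  have B0 : 0 < B by rewrite divr_gt0// powR_gt0.
  pose s := `|S0|; have s_ge0 : 0 <= s by exact: normr_ge0.
  pose kappa := 3 * s * Cth `^ (1 - r) + 3 * Num.sqrt (B * (Cth / 2) `^ (2 - q / 2)).
  have k0 : 0 <= kappa.
    by rewrite addr_ge0// mulr_ge0 ?sqrtr_ge0// ?powR_ge0// mulr_ge0.
  (* rho <= eta makes kappa * rho^(1-r) at most eps0 / 2 *)
  pose eta := Num.min 1 ((eps0 / 2 / (kappa + 1)) `^ (1 - r)^-1).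
  have z0 : 0 < eps0 / 2 / (kappa + 1) by rewrite !divr_gt0// ltr_pwDr.
  have eta0 : 0 < eta by rewrite lt_min ltr01 powR_gt0.
  exists (2 / eps0 ^+ 2 * kappa + 1); split.
    by rewrite ltr_pwDr// mulr_ge0// divr_ge0// sqr_ge0.
  apply: filterS2 (dim_rate_cvg0 q0 dimo eta0) (nbhs_infty_gt 0) => m hrate m0.
  set rho := dim_rate dim q m in hrate.
  have mR : 0 < Num.sqrt m%:R :> R by rewrite sqrtr_gt0 ltr0n.
  have rho0 : 0 < rho by rewrite divr_gt0// powR_gt0// ltr0n.
  have rho1 : rho <= 1 by apply: (le_trans hrate); rewrite ge_min lexx.
  have small : kappa * rho `^ (1 - r) <= eps0 / 2.
    have h : rho `^ (1 - r) <= eps0 / 2 / (kappa + 1).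
      apply: (@le_trans _ _ (((eps0 / 2 / (kappa + 1)) `^ (1 - r)^-1) `^ (1 - r))).
        apply: ge0_ler_powR; rewrite ?nnegrE ?powR_ge0 ?(ltW r1) ?(ltW rho0)//.
        by apply: (le_trans hrate); rewrite ge_min lexx orbT.
      by rewrite -powRrM mulVf ?gt_eqF// powRr1// ltW.
    apply: (@le_trans _ _ ((kappa + 1) * (eps0 / 2 / (kappa + 1)))).
      by apply: ler_pM => //; rewrite ?powR_ge0// lerDl.
    by rewrite mulrC divfK// gt_eqF// ltr_pwDr.
  have [_ row _ lam] := sparse m m0.
  have err := herr _ _ P e e' _ (G m) m iid (fun t => mG m t m0) (dep m m0) m0.
  have a0 : 0 < B * rho `^ (q / 2) by rewrite mulr_gt0// powR_gt0.
  have cs0 : 0 <= c / Num.sqrt m%:R by rewrite divr_ge0 ?ltW.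
  have [mE PE] := markov_sum p0 cs0 a0 (fun i j => (err i j).1) (fun i j => (err i j).2).
  set bad := [set w | _] in mE PE.
  apply: (@le_trans _ _ (mu_ext P bad)).
    apply: le_mu_ext => w /= hw; rewrite /bad /= ltNge; apply/negP => good.
    move: hw; rewrite ltNge => /negP; apply.
    have rows i : \sum_j abspow r (Sigma_bar m i j) <= s.
      by apply: (le_trans (row i)); apply: (le_trans (s0S _)); exact: ler_norm.
    have := precision_error hS hr0 hr1 Cth0 rho0 rho1 p2 (cov_bar_sym P (Y m) m) e0 lam
      (normr_ge0 S0) rows (ltW B0) good small.
    move/le_trans; apply.
    by apply: ler_wpM2r; [exact: rate0|rewrite lerDl].
  rewrite measurable_mu_extE//; apply: (le_trans PE).
  have v0 : 0 <= (Num.sqrt m%:R)^-1 :> R by rewrite invr_ge0 ltW.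
  rewrite lee_fin /rho /dim_rate (powRM _ (ltW c0) v0) (powRM _ (powR_ge0 _ _) v0) -powRrM.
  have -> : 4 / q * (q / 2) = 2%:R by field; rewrite gt_eqF.
  rewrite powR_mulrn ?ler0n// /B le_eqVlt; apply/orP; left; apply/eqP.
  have h1 : c `^ (q / 2) != 0 by rewrite gt_eqF// powR_gt0.
  have h2 : (Num.sqrt m%:R)^-1 `^ (q / 2) != 0 by rewrite gt_eqF// powR_gt0 ?invr_gt0.
  have h3 : (dim m)%:R != 0 :> R by rewrite pnatr_eq0 -lt0n.
  move: h1 h2 h3; set x := _ `^ _; set y := _ `^ _; set z := (dim m)%:R => h1 h2 h3.
  by field; rewrite h1 h2 h3 gt_eqF.
split; first exact: precision.
move=> f [Lf hf] hmu.
apply: (bigO_prob_lipschitz (L := `|Lf|) rate0 _ precision hmu) => m w.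
rewrite ger0_norm ?norm2_ge0//; apply: (le_trans (hf _ _ _ _ _)).
apply: (@le_trans _ _ (`|Lf| * `|opnorm (Phi_hat m w - Phi_bar m) +
  norm2 (mu_hat m w - mu_bar m)|)).
  by rewrite -normrM ler_norm.
by rewrite ler_wpM2l// ler_normD.
Qed.
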